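(* Let $CE(6)$ be the graph with vertex set $B\uplus R$, where $B=\{b_1,\dots,b_6\}$ and $R=\{r_A : A\subseteq\{1,\dots,6\}\}$ (so $|R|=64$), in which $B$ is a clique, $R$ is an independent set, and $b_i$ is adjacent to $r_A$ if and only if $i\in A$. Then the obstacle number of $CE(6)$ is greater than $1$.
   Context: An obstacle representation of a graph $G$ consists of a finite set $P$ of points in the plane together with a finite set of closed polygonal obstacles (disjoint from $P$) such that the points of $P$ together with the vertices of the obstacles are in general position (no three collinear), and such that the visibility graph is isomorphic to $G$; the visibility graph has vertex set $P$, with $p,q$ adjacent iff the segment $pq$ meets no obstacle. The obstacle number of $G$ is the minimum number of obstacles over all obstacle representations of $G$. *)

(* Defs.v *)
(* The plane is R * R for an arbitrary R : realType. *)
From HB Require Import structures.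
From mathcomp Require Import all_boot all_order all_algebra.
From mathcomp Require Import all_classical all_reals all_analysis.

Set Implicit Arguments.
Unset Strict Implicit.
Unset Printing Implicit Defensive.

Import Order.TTheory GRing.Theory Num.Theory.
Import numFieldNormedType.Exports.
Local Open Scope classical_set_scope.
Local Open Scope ring_scope.

Definition segment (R : realType) (p q : R * R) : set (R * R) :=
  [set ((1 - t) * p.1 + t * q.1, (1 - t) * p.2 + t * q.2) | t in `[0, 1]].

Definition collinear (R : realType) (p q r : R * R) : Prop :=
  exists a b c : R, (a, b) <> (0, 0) /\
    [/\ a * p.1 + b * p.2 = c, a * q.1 + b * q.2 = c & a * r.1 + b * r.2 = c].

Definition general_position (R : realType) (A : set (R * R)) : Prop :=
  forall p q r, A p -> A q -> A r -> p <> q -> q <> r -> p <> r ->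
    ~ collinear p q r.

(* A polygon is given by the cyclic sequence s of its vertices; [side s i] is
   the closed side from vertex i to vertex i + 1, modulo the length of s. *)
Definition vertex (R : realType) (s : seq (R * R)) (i : nat) : R * R :=
  nth (0, 0) s (i %% size s).

Definition side (R : realType) (s : seq (R * R)) (i : nat) : set (R * R) :=
  segment (vertex s i) (vertex s i.+1).

Definition side_ends (R : realType) (s : seq (R * R)) (i : nat) :
    set (R * R) :=
  [set vertex s i; vertex s i.+1].

(* Two distinct sides meet at most in a common endpoint. As the vertices are
   distinct, nonconsecutive sides are therefore disjoint. *)
Definition simple_polygon (R : realType) (s : seq (R * R)) : Prop :=
  [/\ (3 <= size s)%N, uniq s &
    forall i j, (i < size s)%N -> (j < size s)%N -> i <> j ->
      side s i `&` side s j `<=` side_ends s i `&` side_ends s j].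

Definition polygon_boundary (R : realType) (s : seq (R * R)) : set (R * R) :=
  \bigcup_(i in [set i | (i < size s)%N]) side s i.

(* The points off the boundary curve whose component is bounded. *)
Definition polygon_interior (R : realType) (s : seq (R * R)) : set (R * R) :=
  [set x | ~ polygon_boundary s x /\
           bounded_set (connected_component (~` polygon_boundary s) x)].

Definition polygon (R : realType) (s : seq (R * R)) : set (R * R) :=
  polygon_boundary s `|` polygon_interior s.

(* Adjacency in the visibility graph; O lists the obstacles by their vertex
   sequences. *)
Definition visible (R : realType) (O : seq (seq (R * R))) (p q : R * R) :
    Prop :=
  p <> q /\ forall s, s \in O -> segment p q `&` polygon s = set0.

(* [uniq (map polygon O)] makes [size O] the cardinality of the set of
   obstacles, whatever the choice of vertex sequences. The function f is an
   isomorphism from the graph (T, e) onto the visibility graph on P. *)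
Definition obstacle_representation (R : realType) (T : finType) (e : rel T)
    (P : set (R * R)) (O : seq (seq (R * R))) : Prop :=
  [/\ finite_set P,
      uniq (map (@polygon R) O) /\ (forall s, s \in O -> simple_polygon s),
      forall s, s \in O -> P `&` polygon s = set0,
      general_position (P `|` [set v | exists2 s, s \in O & v \in s]) &
      exists f : T -> R * R, [/\ injective f, range f = P &
        forall u v, e u v <-> visible O (f u) (f v)]].

(* An infimum of natural numbers, hence a minimum unless there is no
   representation at all, when it is +oo. *)
Definition obstacle_number (R : realType) (T : finType) (e : rel T) : \bar R :=
  ereal_inf [set ((size O)%:R)%:E | O in
    [set O : seq (seq (R * R)) | exists P, obstacle_representation e P O]].

(* [inl i] is the vertex b_i and [inr A] is the vertex r_A. *)
Definition CE (k : nat) : rel ('I_k + {set 'I_k})%type := fun u v =>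
  match u, v with
  | inl i, inl j => i != j
  | inl i, inr A | inr A, inl i => i \in A
  | inr _, inr _ => false
  end.
Arguments CE k%_nat_scope u v : clear implicits.

(* Main.v *)
(* Only the boundary X of the obstacle matters: it is connected, and a segment
   between two points outside the obstacle that meets the obstacle meets X.
   Segments from r_A to b_i miss X exactly when i is in A, and segments between
   blue points miss X, so X lies in the interior of a triangle of blue points as
   soon as it meets it.

   If X lies in such a triangle b_1 b_2 b_3, take one without blue points
   inside. When A contains at most one of 1, 2, 3, r_A is in the triangle, and
   no two visible points separate two blocked ones in the circular order around
   r_A. Applied to A = {3, x}, this forbids a point x beyond the edge b_1 b_2
   only; hence the other three points lie in the regions opposite to the
   triangle at its vertices. One in each region contradicts the view from r_A
   when A consists of them, and two in the same region contradict two views of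
   type {2, x}, {3, y}.

   Otherwise X is outside all blue triangles, and for visible j and k the
   blocked points are all in the convex cone from r_A through b_j and b_k, or
   all outside it. If b_p is in a triangle T of blue points, then X is, as seen
   from r_T, on one side of each b_i with i in T, and for two such triangles T
   and T' the sides of i in T \ T' and m in T' \ T differ, because otherwise X
   would cross the segment b_i b_m. The triangles around b_p always provide a
   closed walk of odd length of such pairs, which cannot be 2-colored. Finally,
   if the six points are in convex position, the view from r_A is contradictory
   when A consists of every other vertex of the hexagon. *)

Require Import Defs.
From mathcomp Require Import all_boot all_order all_algebra.
From mathcomp Require Import all_classical all_reals all_analysis.
From mathcomp Require Import ring lra.

Set Implicit Arguments.
Unset Strict Implicit.
Unset Printing Implicit Defensive.

Import Order.TTheory GRing.Theory Num.Theory.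
Import numFieldNormedType.Exports.

(** * Tournaments *)

Fixpoint all_bits (n : nat) (P : seq bool -> bool) : bool :=
  if n is m.+1
  then all_bits m (fun s => P (true :: s)) && all_bits m
    (fun s => P (false :: s))
  else P [::].

Lemma all_bitsP n P : all_bits n P -> forall s, size s = n -> P s.
Proof.
elim: n P => [|n IHn] P /=; first by move=> P0 [].
move=> /andP[Pt Pf] [//|[] s] [sz].
  exact: (IHn (fun s => P (true :: s))).
exact: (IHn (fun s => P (false :: s))).
Qed.

(* A tournament on 0, ..., n - 1 is encoded by listing, for each j in turn, the
   arcs i -> j with i < j. *)
Definition code_tournament n (t : rel nat) : seq bool :=
  flatten [seq [seq t i j | i <- iota 0 j] | j <- iota 0 n].

(** The block of [j] starts at position ['C(j, 2)] of the code, as the earlier blocks have lengths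
    0, ..., j - 1. *)
Definition tournament_of n (s : seq bool) : rel nat :=
  let m := mkseq (fun i => mkseq (fun j =>
    if i < j then nth false s ('C(j, 2) + i)
    else (j < i) && ~~ nth false s ('C(i, 2) + j)) n) n in
  fun i j => nth false (nth [::] m i) j.

Definition triples n : seq (nat * nat * nat) :=
  [seq (x, k) | x <- [seq (i, j) | i <- iota 0 n, j <- iota 0 n],
    k <- iota 0 n].

Definition increasing3 n : seq (nat * nat * nat) :=
  [seq (x, k) | x <- [seq (i, j) | j <- iota 0 n, i <- iota 0 j],
                k <- iota x.2.+1 (n - x.2.+1)].

(* If [t i j] tells on which side of the ray from p to i the point j is, this
   means that p is in the triangle i j k. *)
Definition cyc3 (t : rel nat) (i j k : nat) : bool :=
  (t i j == t j k) && (t j k == t k i).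

(** Vectors in an open half-plane are linearly ordered by angle, so a tournament of directions has
    no cyclic triple among the out-neighbours or among the in-neighbours of a vertex. *)
Definition locally_transitive n (t : rel nat) : bool :=
  all (fun i => all (fun x => let: (j, k, l) := x in
    [|| i \in [:: j; k; l], t i j != t i k, t i k != t i l | ~~ cyc3 t j k l])
  (increasing3 n)) (iota 0 n).

(** The first vertex of each triangle is marked. When neither marked vertex belongs to the other
    triangle, the obstacle has to be on different sides of the two. *)
Definition conflict (t : rel nat) (x y : nat * nat * nat) : bool :=
  let: (i, j, k) := x in let: (i', j', k') := y in
  [&& cyc3 t i j k, cyc3 t i' j' k', i \notin [:: i'; j'; k']
    & i' \notin [:: i; j; k]].

Definition wf_triple n (x : nat * nat * nat) : bool :=
  let: (i, j, k) := x in [&& uniq [:: i; j; k], i < n, j < n & k < n].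

(* The three ways in which five vectors in general position can positively span
   the plane, up to moving a vector without crossing the opposite of another
   one: multiplicities 3, 1, 1 or 2, 2, 1 on a triangle, and the regular
   pentagon. *)
Definition conflict_walks (p : seq nat) : seq (seq (nat * nat * nat)) :=
  [seq [seq (nth 0 p x.1.1, nth 0 p x.1.2, nth 0 p x.2) | x <- l] | l <-
    [:: [:: (0, 3, 4); (1, 3, 4); (2, 3, 4)];
        [:: (0, 2, 4); (1, 3, 4); (0, 3, 4); (2, 1, 4); (3, 1, 4)];
        [:: (0, 2, 3); (1, 3, 4); (2, 4, 0); (3, 0, 1); (4, 1, 2)]]].

Definition odd_conflict_walk n (t : rel nat) (l : seq (nat * nat * nat)) :=
  [&& odd (size l), cycle (conflict t) l & all (wf_triple n) l].

(** A cyclic triple must come with an odd conflict walk, up to relabelling; without one, some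
    permutation must sort the tournament. The search by [find] stops at the first success even under
    call-by-value evaluation. *)
Definition tournament5_check (t : rel nat) : bool :=
  let good :=
    if has (fun x => [&& uniq [:: x.1.1; x.1.2; x.2] & cyc3 t x.1.1 x.1.2 x.2])
           (triples 5)
    then fun p => has (odd_conflict_walk 5 t) (conflict_walks p) else pairwise
      t in
  let ps := permutations (iota 0 5) in
  if locally_transitive 5 t then find good ps < size ps else true.

Lemma tournament5_all :
  all_bits 10 (fun s => tournament5_check (tournament_of 5 s)).
Proof. by vm_compute. Qed.

(** All three values are true or all are false, which covers both orientations of the convex cone
    spanned by j and k. *)
Definition in_cone_rel (t : rel nat) (j k p : nat) : bool :=
  (t j k == t j p) && (t j p == t p k).

(* The view from a point of the plane of a convex hexagon 0 1 2 3 4 5 of which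
   it sees 0, 2, 4 only: as the segments a c and b d cross when a < b < c < d,
   they are not on different sides. *)
Definition hexagon_check (t : rel nat) : bool :=
  if all (fun x => ~~ cyc3 t x.1.1 x.1.2 x.2) (increasing3 6) then
  ~~ (all (fun x => let: (a, b, c) := x in all (fun d => [|| d <= c,
        t a b != t a d, t a d != t c b | t c b != t c d])
         (iota 0 6)) (increasing3 6)
    && all (fun x => let: (j, k) := x in all (fun y => let: (p, q) := y in
       in_cone_rel t j k p == in_cone_rel t j k q)
        [:: (1, 3); (3, 5)]) [:: (0, 2); (2, 4); (0, 4)])
  else true.

Lemma hexagon_all : all_bits 15 (fun s => hexagon_check (tournament_of 6 s)).
Proof. by vm_compute. Qed.

Lemma tournament5_ofK (t : rel nat) i j : i < 5 -> j < 5 -> i != j ->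
  t j i = ~~ t i j -> tournament_of 5 (code_tournament 5 t) i j = t i j.
Proof.
by case: i => [|[|[|[|[|//]]]]]; case: j => [|[|[|[|[|//]]]]] // _ _ _ H;
  rewrite /tournament_of /code_tournament /= ?H ?negbK.
Qed.

Lemma tournament6_ofK (t : rel nat) i j : i < 6 -> j < 6 -> i != j ->
  t j i = ~~ t i j -> tournament_of 6 (code_tournament 6 t) i j = t i j.
Proof.
by case: i => [|[|[|[|[|[|//]]]]]]; case: j => [|[|[|[|[|[|//]]]]]] // _ _ _ H;
  rewrite /tournament_of /code_tournament /= ?H ?negbK.
Qed.

(** Each step of a walk flips the color, so the color at its end records the parity of its
    length. *)
Lemma odd_cycle_coloring (T : eqType) (e : rel T) (c : T -> bool) (s : seq T) :
  {in s &, forall x y, e x y -> c x != c y} -> cycle e s -> ~~ odd (size s).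
Proof.
case: s => [//|x s] ce /= xs.
have H q y : y \in x :: s -> {subset q <= x :: s} -> path e y q ->
    c (last y q) = c y (+) odd (size q).
  elim: q y => [|z q IHq] y ys qs /=; first by rewrite addbF.
  have zs : z \in x :: s by apply: qs; rewrite inE eqxx.
  move=> /andP[/(ce _ _ ys zs) yz /IHq -> //]; last first.
    by move=> w wq; apply: qs; rewrite inE wq orbT.
  by case: (c z) (c y) yz => -[]; case: (odd _).
have sub : {subset rcons s x <= x :: s} by move=> w; rewrite mem_rcons.
have := H _ _ (mem_head x s) sub xs.
by rewrite last_rcons size_rcons /=; case: (c x); case: (odd _).
Qed.

Local Open Scope classical_set_scope.
Local Open Scope ring_scope.

(** * Orientation *)

(** Twice the signed area of the triangle p q r, positive when it is counterclockwise. *)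
Definition orient (R : realFieldType) (p q r : R * R) : R :=
  (q.1 - p.1) * (r.2 - p.2) - (q.2 - p.2) * (r.1 - p.1).

Definition lerp (R : realFieldType) (t : R) (p q : R * R) : R * R :=
  ((1 - t) * p.1 + t * q.1, (1 - t) * p.2 + t * q.2).

Section Orientation.
Variable R : realFieldType.
Implicit Types (p q r z i m : R * R) (t : R).

Lemma orient_rot p q r : orient p q r = orient q r p.
Proof. rewrite /orient; ring. Qed.

Lemma orient_swap p q r : orient p q r = - orient p r q.
Proof. rewrite /orient; ring. Qed.

Lemma orient_flip p q r : orient q p r = - orient p q r.
Proof. rewrite /orient; ring. Qed.

Lemma orientpp p q : orient p p q = 0.
Proof. rewrite /orient; ring. Qed.

Lemma orient_sum p q r z :
  orient p q z + orient q r z + orient r p z = orient p q r.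
Proof. rewrite /orient; ring. Qed.

Lemma orient_lerp p q t r s :
  orient p q (lerp t r s) = (1 - t) * orient p q r + t * orient p q s.
Proof. rewrite /orient /lerp /=; ring. Qed.

Lemma orientpq p q : orient p q p = 0 /\ orient p q q = 0.
Proof. by split; rewrite /orient; ring. Qed.

Lemma orient_lerp_from t p q r :
  orient p q (lerp t p r) = t * orient p q r /\
  orient q p (lerp t p r) = t * orient q p r.
Proof. by split; rewrite /orient /lerp /=; ring. Qed.

Lemma orient_lerp_to t p q r :
  orient p q (lerp t r p) = (1 - t) * orient p q r /\
  orient q p (lerp t r p) = (1 - t) * orient q p r.
Proof. by split; rewrite /orient /lerp /=; ring. Qed.

(** The areas on the right that involve z are its unnormalized barycentric coordinates in p q r, and
    [orient a b] is affine. *)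
Lemma orient_bary p q r z a b:
  orient p q r * orient a b z
  = orient q r z * orient a b p + orient r p z * orient a b q
    + orient p q z * orient a b r.
Proof. rewrite /orient; ring. Qed.

(** The Grassmann-Plücker relation for the four vectors from r. *)
Lemma orient_gp r a b c d :
  orient r a b * orient r c d - orient r a c * orient r b d
  + orient r a d * orient r b c = 0.
Proof. rewrite /orient; ring. Qed.

(** The crossing of the lines a c and b d is a combination of a, c with weights b c d, a b d, and of
    b, d with weights a c d, a b c. The determinant of these two parallel vectors from r
    vanishes. *)
Lemma orient_crossing r a b c d :
  orient b c d * orient a c d * orient r a b
  + orient b c d * orient a b c * orient r a d
  + orient a b d * orient a c d * orient r c b
  + orient a b d * orient a b c * orient r c d = 0.
Proof. rewrite /orient; ring. Qed.

Lemma lerp_bary p q z t : orient p q z = 0 -> forall r, orient p q r != 0 ->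
  orient r p z = t * orient p q r -> z = lerp t p q.
Proof.
move=> z0 r d0 tE.
have E1 : orient p q r * z.1 = orient p q r * (lerp t p q).1.
  transitivity (orient q r z * p.1 + orient r p z * q.1 + orient p q z * r.1).
    by rewrite /orient; ring.
  have -> : orient q r z = orient p q r - orient p q z - orient r p z.
    by rewrite -(orient_sum p q r z); ring.
  by rewrite tE z0 /lerp /=; ring.
have E2 : orient p q r * z.2 = orient p q r * (lerp t p q).2.
  transitivity (orient q r z * p.2 + orient r p z * q.2 + orient p q z * r.2).
    by rewrite /orient; ring.
  have -> : orient q r z = orient p q r - orient p q z - orient r p z.
    by rewrite -(orient_sum p q r z); ring.
  by rewrite tE z0 /lerp /=; ring.
case: z E1 E2 {z0 tE} => z1 z2 /= /(mulfI d0) -> /(mulfI d0) ->.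
by [].
Qed.
End Orientation.

(** * Connected sets and polygons *)

(** A single continuous function that is positive exactly on an intersection of open half-planes;
    the initial value 1 only has to be positive. *)
Definition halfplanes (R : realType) (s : seq ((R * R) * (R * R))) (z : R * R)
  : R :=
  foldr (fun pq m => Num.min (orient pq.1 pq.2 z) m) 1 s.

Lemma orient_continuous (R : realType) (p q : R * R) :
  continuous (orient p q : R * R -> R^o).
Proof.
move=> z; rewrite /orient; apply: cvgB; apply: cvgM; try exact: cvg_cst;
  apply: cvgB; try exact: cvg_cst; [exact: cvg_snd|exact: cvg_fst].
Qed.

Lemma halfplanes_continuous (R : realType) (s : seq ((R * R) * (R * R))) :
  continuous (halfplanes s : R * R -> R^o).
Proof.
elim: s => [|pq s IHs] z; first exact: cvg_cst.
apply: continuous_min; [exact: orient_continuous|exact: IHs].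
Qed.

Lemma halfplanes_gt0 (R : realType) (s : seq ((R * R) * (R * R))) z :
  (0 < halfplanes s z) = all (fun pq => 0 < orient pq.1 pq.2 z) s.
Proof. by elim: s => [|pq s IHs] /=; rewrite ?ltr01// lt_min IHs. Qed.

Lemma halfplanes_eq0 (R : realType) (s : seq ((R * R) * (R * R))) z :
  halfplanes s z = 0 -> all (fun pq => 0 <= orient pq.1 pq.2 z) s /\
    has (fun pq => orient pq.1 pq.2 z == 0) s.
Proof.
move=> s0; have : 0 <= halfplanes s z by rewrite s0.
have -> : (0 <= halfplanes s z) = all (fun pq => 0 <= orient pq.1 pq.2 z) s.
  by elim: s {s0} => [|pq s IHs] /=; rewrite ?ler01// le_min IHs.
move=> s_ge0; split=> //; elim: s s0 {s_ge0} => [/eqP|pq s IHs] /=;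
  first by rewrite oner_eq0.
by rewrite minEle; case: ifP => [_ ->|_ /IHs ->]; rewrite ?eqxx ?orbT.
Qed.

(** The image of X under [halfplanes s] is an interval with a positive and a nonpositive element,
    hence contains 0. *)
Lemma connected_halfplanes (R : realType) (X : set (R * R))
    (s : seq ((R * R) * (R * R))) z0 z1 :
  connected X -> X z0 -> X z1 ->
  all (fun pq => 0 < orient pq.1 pq.2 z0) s ->
  ~~ all (fun pq => 0 < orient pq.1 pq.2 z1) s ->
  exists z, [/\ X z, all (fun pq => 0 <= orient pq.1 pq.2 z) s &
    has (fun pq => orient pq.1 pq.2 z == 0) s].
Proof.
move=> cX Xz0 Xz1; rewrite -!halfplanes_gt0 -leNgt => z0_gt0 z1_le0.
have /connected_intervalP : connected (halfplanes s @` X).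
  apply: connected_continuous_connected => //.
  exact/continuous_subspaceT/halfplanes_continuous.
move=> /(_ (halfplanes s z1) (halfplanes s z0)).
move=> /(_ (ex_intro2 _ _ z1 Xz1 erefl) (ex_intro2 _ _ z0 Xz0 erefl) 0).
rewrite z1_le0 ltW// => /(_ isT)[z Xz /halfplanes_eq0[? ?]].
by exists z; split.
Qed.

Lemma segment_lerp (R : realType) (p q z : R * R) :
  segment p q z <-> exists t, 0 <= t <= 1 /\ z = lerp t p q.
Proof.
split=> [[t /=]|[t [t01 ->]]]; first by rewrite in_itv /= => t01 <-; exists t.
by exists t => //=; rewrite in_itv.
Qed.

Lemma connected_segment (R : realType) (p q : R * R) : connected (segment p q).
Proof.
apply: connected_continuous_connected; first exact: segment_connected.
apply: continuous_subspaceT => t.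
have lin (a b : R) : ((1 - u) * a + u * b : R) @[u --> t] --> (1 - t) * a + t
  * b.
  apply: cvgD; apply: cvgM; [|exact: cvg_cst|exact: cvg_id|exact: cvg_cst].
  by apply: cvgB; [exact: cvg_cst|exact: cvg_id].
exact: (cvg_pair (lin p.1 q.1) (lin p.2 q.2)).
Qed.

Lemma segment_l (R : realType) (p q : R * R) : segment p q p.
Proof.
apply/segment_lerp; exists 0; rewrite lexx ler01 /lerp; split=> //.
by rewrite subr0 !mul1r !mul0r !addr0; case: p.
Qed.

Lemma segment_r (R : realType) (p q : R * R) : segment p q q.
Proof.
apply/segment_lerp; exists 1; rewrite lexx ler01 /lerp; split=> //.
by rewrite subrr !mul1r !mul0r !add0r; case: q.
Qed.

Lemma polygon_boundary_connected (R : realType) (s : seq (R * R)) :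
  connected (polygon_boundary s).
Proof.
(* Sides are added one at a time, each sharing a vertex with the previous one; n is unbounded
   because [vertex] reduces indices modulo the length. *)
suff H n : connected (\bigcup_(i in [set i | (i < n)%N]) side s i) by exact: H.
elim: n => [|[|n] IHn].
- by rewrite [X in connected X](_ : _ = set0)//;
  [exact: connected0|rewrite -subset0 => z []].
- rewrite [X in connected X](_ : _ = side s 0); first exact: connected_segment.
  apply/seteqP; split=> z; first by move=> [[|//]].
  by exists 0%N.
rewrite [X in connected X](_ : _ =
  \bigcup_(i in [set i | (i < n.+1)%N]) side s i `|` side s n.+1).
  apply: connectedU => //; last exact: connected_segment.
  exists (vertex s n.+1); split; last exact: segment_l.
  by exists n => /=; [exact: ltnSn|exact: segment_r].
apply/seteqP; split=> z.
  move=> [i /=]; rewrite ltnS leq_eqVlt => /predU1P[->|ilt] zi; first by right.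
  by left; exists i.
by move=> [[i /= ilt zi]|zi]; [exists i => //=; exact: ltnW|exists n.+1 => /=].
Qed.

(** A segment off the boundary that reaches an interior point stays in one component of the
    complement, which is bounded; then p would be interior too. *)
Lemma segment_polygon_boundary (R : realType) (s : seq (R * R)) (p q : R * R) :
  ~ polygon s p -> segment p q `&` polygon s !=set0 ->
  segment p q `&` polygon_boundary s !=set0.
Proof.
move=> sp [x [pqx [bx|[nbx bddx]]]]; first by exists x.
apply: contrapT => miss.
have sub : segment p q `<=` ~` polygon_boundary s.
  by move=> z pqz bz; apply: miss; exists z.
apply: sp; right; split; first exact/sub/segment_l.
have -> : connected_component (~` polygon_boundary s) p =
          connected_component (~` polygon_boundary s) x; last by [].
  apply/esym/same_connected_component; exists (segment p q);
    last exact: segment_l.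
  by split=> //; exact: connected_segment.
Qed.

(** * Triangles and cones that confine a connected set *)

Section ConnectedSets.
Variable R : realType.
Implicit Types (X : set (R * R)) (t : R).
Implicit Types a b i j k l m p q r u v x y z : R * R.

Definition misses X p q : Prop := forall z, segment p q z -> ~ X z.

(** The parameter is strictly between 0 and 1 so that orientations at the blocking point inherit
    strict signs. *)
Definition meets X p q : Prop := exists2 t, 0 < t < 1 & X (lerp t p q).

(** The open triangle, for counterclockwise p, q, r only: a clockwise triple admits no z. *)
Definition tri p q r z : Prop :=
  [/\ 0 < orient p q z, 0 < orient q r z & 0 < orient r p z].

Definition cone r j k p : Prop :=
  [/\ 0 < orient r j k, 0 < orient r j p & 0 < orient r p k].

Lemma misses_sym X p q : misses X p q -> misses X q p.
Proof.
move=> miss z /segment_lerp[t [t01 ->]]; apply: miss; apply/segment_lerp.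
exists (1 - t); split; first lra.
by rewrite /lerp; congr pair; ring.
Qed.

Lemma tri_rot p q r z : tri p q r z -> tri q r p z.
Proof. by case. Qed.

Lemma tri_orient p q r z : tri p q r z -> 0 < orient p q r.
Proof. by case=> pq qr rp; rewrite -(orient_sum p q r z); lra. Qed.

Lemma segment_side p q r z : 0 < orient p q r -> orient p q z = 0 ->
  0 <= orient q r z -> 0 <= orient r p z -> segment p q z.
Proof.
move=> pqr pq qr rp; apply/segment_lerp; exists (orient r p z / orient p q r).
have sum := orient_sum p q r z.
split; last by apply: (@lerp_bary _ _ _ _ _ pq r); rewrite ?divfK ?gt_eqF.
apply/andP; split; first by apply: divr_ge0 => //; exact: ltW.
by rewrite ler_pdivrMr// mul1r; lra.
Qed.

(** To leave the triangle, X would have to cross one of the sides that it misses. *)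
Lemma tri_dichotomy X p q r z0 : connected X ->
  misses X p q -> misses X q r -> misses X r p -> X z0 -> tri p q r z0 ->
  forall z, X z -> tri p q r z.
Proof.
move=> cX pq qr rp Xz0 tz0 z1 Xz1; have pqr := tri_orient tz0.
case: tz0 => pq0 qr0 rp0; apply: contrapT => ntri.
have [|/=|z [Xz]] := @connected_halfplanes _ X [:: (p, q); (q, r); (r, p)] _ _
  cX Xz0 Xz1.
- by rewrite /= pq0 qr0 rp0.
- by apply/negP => /and4P[? ? ? _]; apply: ntri; split.
move=> /= /and4P[pqz qrz rpz _] /or4P[|||//] /eqP z0E.
- by apply: (pq z) => //; apply: (@segment_side _ _ r).
- by apply: (qr z) => //; apply: (@segment_side _ _ p) => //;
  rewrite -orient_rot.
- by apply: (rp z) => //; apply: (@segment_side _ _ q) => //;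
  rewrite orient_rot.
Qed.

(** The three cases are a point before, on or beyond the segment j k. *)
Lemma cone_lerp r j k p t : cone r j k p -> 0 < t < 1 ->
  [\/ tri r j k (lerp t r p),
    segment j k (lerp t r p) | tri k j p (lerp t r p)].
Proof.
move=> [rjk rjp rpk] /andP[t0]; rewrite -subr_gt0 => t1; set z := lerp t r p.
have rjz : 0 < orient r j z by rewrite (orient_lerp_from _ _ _ _).1 mulr_gt0.
have krz : 0 < orient k r z.
  by rewrite (orient_lerp_from _ _ _ _).2 mulr_gt0// orient_rot.
have [jkz|jkz|jkz] := ltgtP 0 (orient j k z).
- by constructor 1.
- constructor 3; split.
  + by rewrite orient_flip oppr_gt0.
  + by rewrite (orient_lerp_to _ _ _ _).2 mulr_gt0// -orient_rot.
  + by rewrite (orient_lerp_to _ _ _ _).1 mulr_gt0// -orient_rot.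
- constructor 2; apply: (@segment_side _ _ r); rewrite ?(ltW krz) ?(ltW rjz)//.
  by rewrite -orient_rot.
Qed.

Lemma outer_cone X r j k p : connected X ->
  misses X r j -> misses X r k -> misses X j k ->
  (forall z, X z -> ~ tri k j p z) -> meets X r p -> cone r j k p ->
  forall z, X z -> tri r j k z.
Proof.
move=> cX rj rk jk out [t t01 Xt] cn.
have [tz|sz|tz] := cone_lerp cn t01.
- by apply: (tri_dichotomy cX) tz => //; exact: misses_sym.
- by case: (jk _ sz).
- by case: (out _ Xt).
Qed.

Lemma tri_cone_meets X r j k p : (forall z, X z -> tri r j k z) ->
  meets X r p -> cone r j k p.
Proof.
move=> Xtri [t /andP[t0 t1] Xt]; have rjk := tri_orient (Xtri _ Xt).
have [+ _] := Xtri _ Xt.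
rewrite (orient_lerp_from _ _ _ _).1 (orient_lerp_from _ _ _ _).2 !pmulr_rgt0//.
by move=> rjp; rewrite orient_rot => rpk; split.
Qed.

(* X joins two opposite sides of the convex quadrilateral r i r' m and stays
   between the lines of the two others, so it meets the diagonal i m. *)
Lemma crossing_signs X r r' i m (e : R) : connected X -> e = 1 \/ e = -1 ->
  misses X i m -> meets X r m -> meets X r' i ->
  (forall z, X z -> 0 < e * orient r i z) ->
  (forall z, X z -> 0 < e * orient r' m z) -> False.
Proof.
move=> cX e1 im [t /andP[t0 +] Xt] [s /andP[s0 +] Xs] ri r'm.
rewrite -[t < 1]subr_gt0 -[s < 1]subr_gt0 => t1 s1.
have rim : 0 < e * orient r i m.
  by have := ri _ Xt; rewrite (orient_lerp_from _ _ _ _).1 mulrCA pmulr_rgt0.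
have r'mi : 0 < e * orient r' m i.
  by have := r'm _ Xs; rewrite (orient_lerp_from _ _ _ _).1 mulrCA pmulr_rgt0.
have imt : 0 < e * orient i m (lerp t r m).
  by rewrite (orient_lerp_to _ _ _ _).2 mulrCA mulr_gt0// -orient_rot.
have ims : e * orient i m (lerp s r' i) < 0.
  rewrite (orient_lerp_to _ _ _ _).1 mulrCA pmulr_rlt0//.
  by rewrite -orient_rot orient_swap mulrN oppr_lt0.
(* The two blocking points are on opposite sides of the line i m; [e] tells which one is on the
   positive side. *)
have [z Xz imz] : exists2 z, X z & orient i m z = 0.
  case: e1 imt ims => ->; rewrite !(mul1r, mulN1r) ?oppr_gt0 ?oppr_lt0 => pt ps.
    have [|/=|z [Xz _]] := @connected_halfplanes _ X [:: (i, m)] _ _ cX Xt Xs.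
    - by rewrite /= pt.
    - by rewrite andbT -leNgt ltW.
    - by rewrite /= orbF => /eqP; exists z.
  have [|/=|z [Xz _]] := @connected_halfplanes _ X [:: (i, m)] _ _ cX Xs Xt.
  - by rewrite /= ps.
  - by rewrite andbT -leNgt ltW.
  - by rewrite /= orbF => /eqP; exists z.
have n0 : orient i m r != 0.
  by rewrite -orient_rot; apply: contraTneq rim => ->; rewrite mulr0 ltxx.
(* The parameter of z on the line i m; the sides of r i and of r' m on which X lies give 0 < u and u
   < 1. *)
pose u := orient r i z / orient i m r.
have uE : orient r i z = u * orient i m r by rewrite /u divfK.
have zE : z = lerp u i m by exact: lerp_bary uE.
have u0 : 0 < u.
  by have := ri _ Xz; rewrite uE mulrCA pmulr_lgt0// -orient_rot.
have u1 : u < 1.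
  have := r'm _ Xz; rewrite zE (orient_lerp_to _ _ _ _).2 mulrCA pmulr_lgt0//.
  by rewrite subr_gt0.
apply: (im z) => //; apply/segment_lerp; exists u; split=> //.
by rewrite !ltW.
Qed.

Lemma tri_sub i j k r z : tri i j k r -> tri r i j z -> tri i j k z.
Proof.
move=> [ijr jkr kir] [riz ijz jrz].
have ijk : 0 < orient i j k by rewrite -(orient_sum i j k r); lra.
have rij : 0 < orient r i j by rewrite orient_rot.
split=> //.
- rewrite -(pmulr_rgt0 _ rij) (orient_bary r i j z j k).
  rewrite (orientpq j k).1 mulr0 addr0 addr_gt0// mulr_gt0//.
  by rewrite -orient_rot.
- rewrite -(pmulr_rgt0 _ rij) (orient_bary r i j z k i).
  rewrite (orientpq k i).2 mulr0 addr0 addr_gt0// mulr_gt0//.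
  by rewrite orient_rot.
Qed.

Lemma tri_lerp i j k r t : tri i j k r -> 0 < t < 1 -> tri i j k (lerp t r i).
Proof.
move=> tr /andP[t0]; rewrite -subr_gt0 => t1; have ijk := tri_orient tr.
case: tr => ijr jkr kir; split.
- by rewrite (orient_lerp_to _ _ _ _).1 mulr_gt0.
- by rewrite orient_lerp addr_gt0// mulr_gt0// -orient_rot.
- by rewrite (orient_lerp_to _ _ _ _).2 mulr_gt0.
Qed.

(** Seen from r, the points j, l, k appear in this order within a half-plane, and p is a positive
    combination of them. *)
Lemma tri_cone r j l k p : 0 < orient r j l -> 0 < orient r l k ->
  0 < orient r j k -> tri j l k p \/ tri k l j p ->
  0 < orient r j p /\ 0 < orient r p k.
Proof.
move=> rjl rlk rjk.
have kl : orient r k l < 0 by rewrite orient_swap oppr_lt0.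
have kj : orient r k j < 0 by rewrite orient_swap oppr_lt0.
case=> tp; have d := tri_orient tp; case: tp => t1 t2 t3.
- have B1 := orient_bary j l k p r j; have B2 := orient_bary j l k p r k.
  rewrite (orientpq r j).2 mulr0 add0r in B1.
  rewrite (orientpq r k).2 mulr0 addr0 in B2.
  split.
    by rewrite -(pmulr_rgt0 _ d) B1 addr_gt0// mulr_gt0.
  rewrite orient_swap oppr_gt0 -(pmulr_rlt0 _ d) B2 -oppr_gt0 opprD -!mulrN.
  by rewrite addr_gt0// mulr_gt0// oppr_gt0.
- have B1 := orient_bary k l j p r j; have B2 := orient_bary k l j p r k.
  rewrite (orientpq r j).2 mulr0 addr0 in B1.
  rewrite (orientpq r k).2 mulr0 add0r in B2.
  split.
    by rewrite -(pmulr_rgt0 _ d) B1 addr_gt0// mulr_gt0.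
  rewrite orient_swap oppr_gt0 -(pmulr_rlt0 _ d) B2 -oppr_gt0 opprD -!mulrN.
  by rewrite addr_gt0// mulr_gt0// oppr_gt0.
Qed.

Lemma cone_of_tri i j k r p : tri i j k r -> orient r i p != 0 ->
  orient r j p != 0 -> orient r k p != 0 ->
  [\/ cone r i j p, cone r j k p | cone r k i p].
Proof.
move=> tr; have ijk := tri_orient tr; case: tr => ijr jkr kir.
(* As r is a positive combination of i, j, k, the three orientations of p have a vanishing positive
   combination; their signs are mixed, and the cyclic change from positive to negative gives the
   cone. *)
have B : orient j k r * orient r i p + orient k i r * orient r j p
    + orient i j r * orient r k p = 0.
  by rewrite /orient; ring.
have rij : 0 < orient r i j by rewrite orient_rot.
have rjk : 0 < orient r j k by rewrite orient_rot.
have rki : 0 < orient r k i by rewrite orient_rot.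
rewrite /cone ![orient r p _]orient_swap !oppr_gt0.
case: (ltgtP 0 (orient r i p)) => // ip _;
  case: (ltgtP 0 (orient r j p)) => // jp _;
  case: (ltgtP 0 (orient r k p)) => // kp _;
    try by [constructor 1|constructor 2|constructor 3].
- have := mulr_gt0 jkr ip; have := mulr_gt0 kir jp; have := mulr_gt0 ijr kp;
  lra.
- have : orient j k r * orient r i p < 0 by rewrite pmulr_rlt0.
  have : orient k i r * orient r j p < 0 by rewrite pmulr_rlt0.
  have : orient i j r * orient r k p < 0 by rewrite pmulr_rlt0.
  lra.
Qed.

Lemma tri_convex i j k p q t : tri i j k p -> tri i j k q -> 0 <= t <= 1 ->
  tri i j k (lerp t p q).
Proof.
have pos (a c : R) : 0 < a -> 0 < c -> 0 <= t <= 1 -> 0 < (1 - t) * a + t * c.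
  move=> a0 c0 /andP[]; rewrite le_eqVlt => /predU1P[<- _|t0 t1].
    by rewrite subr0 mul1r mul0r addr0.
  by apply: ltr_wpDl; [apply: mulr_ge0;
    [rewrite subr_ge0|exact: ltW]|exact: mulr_gt0].
by move=> [p1 p2 p3] [q1 q2 q3] t01; split; rewrite orient_lerp; exact: pos.
Qed.

Lemma tri_split i j k q z : tri i j k q -> tri i j k z ->
  [\/ [\/ tri q i j z, tri q j k z | tri q k i z],
      segment q i z, segment q j z | segment q k z].
Proof.
move=> [q1 q2 q3] [z1 z2 z3].
have qij : 0 < orient q i j by rewrite orient_rot.
have qjk : 0 < orient q j k by rewrite orient_rot.
have qki : 0 < orient q k i by rewrite orient_rot.
have B : orient j k q * orient q i z + orient k i q * orient q j z
    + orient i j q * orient q k z = 0 by rewrite /orient; ring.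
have seg x y : 0 < orient q x y -> 0 < orient x y z -> orient q x z = 0 ->
    orient q y z <= 0 -> segment q x z.
  move=> qxy xyz qx qy; apply: (segment_side qxy qx); first exact: ltW.
  by rewrite orient_flip oppr_ge0.
have tr x y : 0 < orient x y z -> 0 < orient q x z -> orient q y z < 0 ->
  tri q x y z.
  by move=> xyz qx qy; split; rewrite // orient_flip oppr_gt0.
case: (ltgtP 0 (orient q i z)) => qi; case: (ltgtP 0 (orient q j z)) => qj;
  case: (ltgtP 0 (orient q k z)) => qk;
  try (by constructor 1; constructor 1; apply: tr);
  try (by constructor 1; constructor 2; apply: tr);
  try (by constructor 1; constructor 3; apply: tr);
  try (by constructor 2; apply: (seg i j) => //; rewrite -?qj// ltW);
  try (by constructor 3; apply: (seg j k) => //; rewrite -?qk// ltW);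
  try (by constructor 4; apply: (seg k i) => //; rewrite -?qi// ltW);
  exfalso; move: B; rewrite -?qi -?qj -?qk ?mulr0 ?add0r ?addr0 => B.
all: nra.
Qed.

(** On a ray from i, the point r is on the same side of both triangle sides at i as the blocking
    point; the ray from j settles the third side. *)
Lemma tri_meets i j k r X : (forall z, X z -> tri i j k z) ->
  meets X r i -> meets X r j -> tri i j k r.
Proof.
move=> Xt [t /andP[t0 +] Xi] [s /andP[s0 +] Xj]; rewrite -subr_gt0 => t1.
rewrite -subr_gt0 => s1; have [+ _ +] := Xt _ Xi; have [_ + _] := Xt _ Xj.
rewrite !(orient_lerp_to _ _ _ _).1 (orient_lerp_to _ _ _ _).2 !pmulr_rgt0//.
Qed.

(** X cannot cross the rays from r through u and v, so it stays in their cone once one of its points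
    is there. *)
Lemma inner_cone X i j k r u v p q : connected X ->
  (forall z, X z -> tri i j k z) -> tri i j k r ->
  ~ tri i j k u -> ~ tri i j k v -> misses X r u -> misses X r v ->
  meets X r p -> meets X r q -> cone r u v p -> cone r u v q.
Proof.
move=> cX Xt tr nu nv ru rv [t /andP[t0 _] Xp] [s /andP[s0 _] Xq] [ruv rup rpv].
(* A point z of X on the ray through w is beyond w, as the segment r w is missed; but then w is
   between r and z, hence in the triangle by convexity. *)
have exit z w c : X z -> ~ tri i j k w -> misses X r w -> 0 <= c ->
  z = lerp c r w -> False.
  move=> Xz nw rw c0 zE; have [c1|c1] := leP c 1.
    by apply: (rw z) => //; apply/segment_lerp; exists c; rewrite c0.
  have cn0 : c != 0 by rewrite gt_eqF// (lt_trans ltr01).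
  apply: nw; rewrite (_ : w = lerp c^-1 r z); last first.
    by rewrite zE /lerp /=; case: w {rw zE} => w1 w2 /=; congr pair; field.
  apply: tri_convex => //; first exact: Xt.
  by rewrite invr_ge0 c0 invf_le1 ?(lt_trans ltr01)// ltW.
have ruq : orient r u (lerp s r q) = s * orient r u q
  by rewrite (orient_lerp_from _ _ _ _).1.
have vrq : orient v r (lerp s r q) = s * orient v r q
  by rewrite (orient_lerp_from _ _ _ _).2.
have vrE w : orient v r w = orient r w v by rewrite orient_rot.
suff [quz qvz] : 0 < orient r u (lerp s r q) /\ 0 < orient v r (lerp s r q).
  split=> //; first by rewrite -(pmulr_rgt0 _ s0) -ruq.
  by rewrite -(pmulr_rgt0 _ s0) -vrE -vrq.
apply: contrapT => nq.
have [|/=|z [Xz /= /and3P[uz vz _] /or3P[||//]]] :=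
  @connected_halfplanes _ X [:: (r, u); (v, r)] _ _ cX Xp Xq.
- by rewrite /= (orient_lerp_from _ _ _ _).1 (orient_lerp_from _ _ _ _).2 vrE
  !mulr_gt0.
- by apply/negP => /and3P[? ? _]; apply: nq.
- move=> /eqP uz0; apply: (exit z u (orient v r z / orient r u v) Xz nu ru).
    by rewrite divr_ge0// ltW.
  by apply: (lerp_bary uz0 (r := v)); rewrite ?gt_eqF// divfK// gt_eqF.
- move=> /eqP vz0; apply: (exit z v (orient r u z / orient r u v) Xz nv rv).
    by rewrite divr_ge0// ltW.
  have rvz0 : orient r v z = 0 by rewrite orient_flip vz0 oppr0.
  have rvu : orient r v u != 0 by rewrite orient_swap oppr_eq0 gt_eqF.
  apply: (lerp_bary rvz0 rvu).
  by rewrite (orient_flip r u) (orient_swap r v) mulrN divfK// gt_eqF.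
Qed.

Lemma tri_mean i j k r a b : tri i j k r -> 0 <= orient a b i ->
  0 <= orient a b j -> 0 <= orient a b k ->
  (0 < orient a b i) || (0 < orient a b j) || (0 < orient a b k) ->
    0 < orient a b r.
Proof.
move=> tr oi oj ok o; have ijk := tri_orient tr; case: tr => r1 r2 r3.
rewrite -(pmulr_rgt0 _ ijk) orient_bary.
have [m1 m2 m3] := And3 (mulr_ge0 (ltW r2) oi) (mulr_ge0 (ltW r3) oj)
  (mulr_ge0 (ltW r1) ok).
case/orP: o => [/orP[]|] o.
- have := mulr_gt0 r2 o; lra.
- have := mulr_gt0 r3 o; lra.
- have := mulr_gt0 r1 o; lra.
Qed.
End ConnectedSets.

Lemma orient_tournament (R : realType) (q x y : R * R) : orient q x y != 0 ->
  (0 < orient q y x) = ~~ (0 < orient q x y).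
Proof. by move=> n0; rewrite orient_swap oppr_gt0 -leNgt lt_neqAle n0. Qed.

(** * An obstacle inside a triangle of blue points *)

Section Shattering.
Variables (R : realType) (I : finType) (X : set (R * R)).
Variables (b : I -> R * R) (r : {set I} -> R * R).
Hypothesis cX : connected X.
Hypothesis bb : forall i j, i != j -> misses X (b i) (b j).
Hypothesis vis : forall (A : {set I}) i, i \in A -> misses X (r A) (b i).
Hypothesis blk : forall (A : {set I}) i, i \notin A -> meets X (r A) (b i).
Hypothesis genb : forall i j k, uniq [:: i; j; k] ->
  orient (b i) (b j) (b k) != 0.
Hypothesis genr : forall A i j, i != j -> orient (r A) (b i) (b j) != 0.

Lemma orient_neq (p : R * R) i j : orient p (b i) (b j) != 0 -> i != j.
Proof. by apply: contra_neq => ->; rewrite (orientpq p (b j)).2. Qed.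

Lemma orient_neq3 i j k : 0 < orient (b i) (b j) (b k) -> uniq [:: i; j; k].
Proof.
move=> o0; rewrite /= !inE negb_or andbT; apply/andP; split;
  first (apply/andP; split).
- by apply: contraTneq o0 => ->; rewrite orientpp ltxx.
- by apply: contraTneq o0 => ->; rewrite (orientpq _ _).1 ltxx.
- by apply: contraTneq o0 => ->; rewrite (orientpq _ _).2 ltxx.
Qed.

(** Descent on the number of blue points inside: such a point q cuts the triangle into three, X is
    in one of them, and q is no longer inside. *)
Lemma empty_triangle i j k : X !=set0 ->
  (forall z, X z -> tri (b i) (b j) (b k) z) ->
  exists i' j' k', (forall z, X z -> tri (b i') (b j') (b k') z) /\
    forall q, ~ tri (b i') (b j') (b k') (b q).
Proof.
move=> [z0 Xz0].
pose inside i j k : {set I} := [set q | `[< tri (b i) (b j) (b k) (b q) >]]%SET.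
have inE' i' j' k' q : (q \in inside i' j' k') =
  `[< tri (b i') (b j') (b k') (b q) >].
  by rewrite /inside finset.in_set.
have [n] := ubnP #|inside i j k|; elim: n i j k => // n IHn i j k /ltnSE sz Xt.
have [[q tq]|nq] := pselect (exists q, tri (b i) (b j) (b k) (b q)); last first.
  by exists i, j, k; split=> // q tq; apply: nq; exists q.
have sub i' j' k' : tri (b i') (b j') (b k') (b q) ->
    inside i' j' k' = inside i j k -> tri (b q) (b i') (b j') z0 ->
    exists i'' j'' k'', (forall z, X z -> tri (b i'') (b j'') (b k'') z) /\
      forall q, ~ tri (b i'') (b j'') (b k'') (b q).
  move=> tq' E tz; apply: (IHn q i' j'); last first.
    have /and3P[/= ] := orient_neq3 (tri_orient tz); rewrite !inE negb_or.
    move=> /andP[qi qj] ij _.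
    by apply: (tri_dichotomy cX) tz => //; apply: bb => //; rewrite eq_sym.
  apply: leq_trans sz; apply: proper_card; rewrite -E; apply/properP; split.
    by apply/fintype.subsetP => x; rewrite !inE' => /asboolP tx; apply/asboolP;
      exact: tri_sub tq' tx.
  exists q; rewrite inE'; first exact/asboolP.
  by apply/asboolP => -[+ _ _]; rewrite (orientpq _ _).1 ltxx.
have insE i' j' k' : inside j' k' i' = inside i' j' k'.
  apply/setP => x; rewrite !inE'; apply/asboolP/asboolP.
    by move=> /tri_rot/tri_rot.
  exact: tri_rot.
have miss x : x != q -> segment (b q) (b x) z0 -> False.
  by move=> xq s; apply: (bb _ s) => //; rewrite eq_sym.
have neq x y w : tri (b x) (b y) (b w) (b q) -> x != q.
  by case=> _ _; apply: contraTneq => ->; rewrite (orientpq _ _).2 ltxx.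
have tq2 := tri_rot tq; have tq3 := tri_rot tq2.
have [[]|||] := tri_split tq (Xt _ Xz0).
- exact: sub tq erefl.
- exact: (sub _ _ _ tq2 (insE i j k)).
- exact: (sub _ _ _ tq3 (etrans (insE j k i) (insE i j k))).
- by move=> /miss; case=> //; exact: neq tq.
- by move=> /miss; case=> //; exact: neq tq2.
- by move=> /miss; case=> //; exact: neq tq3.
Qed.

Definition empty_tri i j k : Prop :=
  (forall z, X z -> tri (b i) (b j) (b k) z) /\
  (forall q, ~ tri (b i) (b j) (b k) (b q)).

Lemma empty_tri_rot i j k : empty_tri i j k -> empty_tri j k i.
Proof.
by move=> [Xt nq]; split=> [z /Xt/tri_rot|q tq]//;
  exact: (nq q (tri_rot (tri_rot tq))).
Qed.

Lemma inner_tri (A : {set I}) i j k : empty_tri i j k -> i \notin A ->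
  j \notin A ->
  tri (b i) (b j) (b k) (r A).
Proof. by move=> [Xt _] iA jA; apply: (tri_meets Xt); exact: blk. Qed.

(** Emptiness of the triangle puts the visible points u and v outside it, as [inner_cone]
    requires. *)
Lemma inner_key (A : {set I}) i j k u v p q : empty_tri i j k ->
  tri (b i) (b j) (b k) (r A) -> u \in A -> v \in A -> p \notin A ->
    q \notin A ->
  cone (r A) (b u) (b v) (b p) -> cone (r A) (b u) (b v) (b q).
Proof.
move=> [Xt nq] tr uA vA pA qA.
by apply: (inner_cone cX Xt tr);
  [exact: nq|exact: nq|exact: vis|exact: vis|exact: blk|exact: blk].
Qed.

Definition sees_between (A : {set I}) i j u : Prop :=
  0 < orient (r A) (b i) (b u) /\ 0 < orient (r A) (b u) (b j).

(** The visible u and v separate j from i and k in the circular order around r_A. *)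
Lemma gaps_false (A : {set I}) i j k u v : empty_tri i j k ->
  tri (b i) (b j) (b k) (r A) -> i \notin A -> j \notin A -> k \notin A ->
  u \in A -> v \in A -> sees_between A i j u -> sees_between A j k v -> False.
Proof.
move=> et tr iA jA kA uA vA [iu uj] [jv vk].
have ij : 0 < orient (r A) (b i) (b j) by rewrite orient_rot; case: tr.
have jk : 0 < orient (r A) (b j) (b k) by rewrite orient_rot; case: tr.
have ki : 0 < orient (r A) (b k) (b i) by rewrite orient_rot; case: tr.
have neg x y : 0 < orient (r A) (b x) (b y) -> 0 < orient (r A) (b y) (b x) ->
  False.
  by move=> xy; rewrite (orient_swap (r A)) oppr_gt0 => /(lt_trans xy);
    rewrite ltxx.
have key := fun u v p q uA vA pA qA =>
  @inner_key A i j k u v p q et tr uA vA pA qA.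
have nuv : u != v.
  by apply/eqP => E; apply: (neg _ _ uj); rewrite E.
case: (ltgtP 0 (orient (r A) (b u) (b v))) (genr A nuv) => // uv _.
  have [_ ui _] := key u v j i uA vA jA iA (And3 uv uj jv).
  exact: neg iu ui.
have vu : 0 < orient (r A) (b v) (b u) by rewrite (orient_swap (r A)) oppr_gt0.
have nku : k != u by apply: contraNneq kA => ->.
case: (ltgtP 0 (orient (r A) (b k) (b u))) (genr A nku) => // ku _.
  have [_ vj _] := key v u k j vA uA kA jA (And3 vu vk ku).
  exact: neg jv vj.
have uk : 0 < orient (r A) (b u) (b k) by rewrite (orient_swap (r A)) oppr_gt0.
(* Here u, j, v surround r_A, yet k would be on the same side of all three rays. *)
have := orient_gp (r A) (b u) (b j) (b v) (b k).
have := mulr_gt0 uj vk; have := mulr_gt0 vu jk; have := mulr_gt0 uk jv.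
rewrite (orient_swap (r A) (b v) (b u)); lra.
Qed.

(** For A = {k, x}, the point r_A is in the triangle and sees x between the blocked i and j, so the
    visible k and x separate them. *)
Lemma beyond_edge_false i j k x : empty_tri i j k -> uniq [:: i; j; k] ->
  orient (b i) (b j) (b x) < 0 -> 0 < orient (b j) (b k) (b x) ->
  0 < orient (b k) (b i) (b x) -> False.
Proof.
move=> et /= /and3P[]; rewrite !inE negb_or => /andP[nij nik] njk _ ijx jkx kix.
pose A : {set I} := [set k; x]%SET.
have nxi : i != x by apply: contraTneq ijx => <-; rewrite (orientpq _ _).1 ltxx.
have nxj : j != x by apply: contraTneq ijx => <-; rewrite (orientpq _ _).2 ltxx.
have nxk : k != x by apply: contraTneq jkx => <-; rewrite (orientpq _ _).2 ltxx.
have iA : i \notin A by rewrite finset.in_set2 negb_or nik nxi.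
have jA : j \notin A by rewrite finset.in_set2 negb_or njk nxj.
have kA : k \in A by rewrite finset.in_set2 eqxx.
have xA : x \in A by rewrite finset.in_set2 eqxx orbT.
have tr := inner_tri et iA jA.
have ij : 0 < orient (r A) (b i) (b j) by rewrite orient_rot; case: tr.
have jk : 0 < orient (r A) (b j) (b k) by rewrite orient_rot; case: tr.
have ki : 0 < orient (r A) (b k) (b i) by rewrite orient_rot; case: tr.
have ixj : 0 < orient (b i) (b x) (b j) by rewrite orient_swap oppr_gt0.
have ix : 0 < orient (r A) (b i) (b x).
  rewrite orient_rot; apply: (tri_mean tr).
  - by rewrite (orientpq _ _).1.
  - exact: ltW.
  - by rewrite -orient_rot ltW.
  - by rewrite ixj orbT.
have xj : 0 < orient (r A) (b x) (b j).
  rewrite orient_rot; apply: (tri_mean tr).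
  - by rewrite -orient_rot ltW.
  - by rewrite (orientpq _ _).2.
  - by rewrite orient_rot ltW.
  - by rewrite -orient_rot ixj.
have neg u v : 0 < orient (r A) (b u) (b v) -> 0 < orient (r A) (b v) (b u) ->
  False.
  by move=> uv; rewrite (orient_swap (r A)) oppr_gt0 => /(lt_trans uv);
    rewrite ltxx.
case: (ltgtP 0 (orient (r A) (b k) (b x))) (genr A nxk) => // kx _.
  have [_ kj _] := inner_key et tr kA xA iA jA (And3 kx ki ix).
  exact: neg jk kj.
have xk : 0 < orient (r A) (b x) (b k) by rewrite (orient_swap (r A)) oppr_gt0.
have [_ _ ik] := inner_key et tr xA kA jA iA (And3 xk xj jk).
exact: neg ki ik.
Qed.

(** The region vertically opposite to the angle of the triangle at i. *)
Definition beyond_vertex i j k x : Prop :=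
  [/\ orient (b i) (b j) (b x) < 0, 0 < orient (b j) (b k) (b x) &
      orient (b k) (b i) (b x) < 0].

Lemma beyond_vertex_neq i j k u : beyond_vertex i j k u ->
  [/\ i != u, j != u & k != u].
Proof.
move=> [s1 s2 _]; split.
- by apply: contraTneq s1 => <-; rewrite (orientpq _ _).1 ltxx.
- by apply: contraTneq s1 => <-; rewrite (orientpq _ _).2 ltxx.
- by apply: contraTneq s2 => <-; rewrite (orientpq _ _).2 ltxx.
Qed.

(** Of the eight sign patterns, the interior is empty, three are beyond one edge only, and three
    negative signs contradict [orient_sum]. *)
Lemma empty_tri_beyond_vertex i j k x : empty_tri i j k -> X !=set0 ->
  x \notin [:: i; j; k] ->
  [\/ beyond_vertex i j k x, beyond_vertex j k i x | beyond_vertex k i j x].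
Proof.
move=> et [z Xz]; have ijk := tri_orient (et.1 _ Xz).
have U := orient_neq3 ijk; have U' := U.
have et2 := empty_tri_rot et; have et3 := empty_tri_rot et2.
move: U' => /= /and3P[]; rewrite !inE !negb_or =>
  /andP[nij nik] njk _ /and3P[xi xj xk].
have U2 : uniq [:: j; k; i]
  by rewrite /= !inE negb_or njk (eq_sym j) nij (eq_sym k) nik.
have U3 : uniq [:: k; i; j]
  by rewrite /= !inE negb_or (eq_sym k i) nik (eq_sym k j) njk nij.
have n1 : orient (b i) (b j) (b x) != 0.
  by apply: genb; rewrite /= !inE negb_or nij (eq_sym i) xi (eq_sym j) xj.
have n2 : orient (b j) (b k) (b x) != 0.
  by apply: genb; rewrite /= !inE negb_or njk (eq_sym j) xj (eq_sym k) xk.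
have n3 : orient (b k) (b i) (b x) != 0.
  by apply: genb; rewrite /= !inE negb_or (eq_sym k i) nik (eq_sym i) xi
    (eq_sym k) xk.
have S := orient_sum (b i) (b j) (b k) (b x).
case: (ltgtP 0 (orient (b i) (b j) (b x))) n1 => // o1 _;
case: (ltgtP 0 (orient (b j) (b k) (b x))) n2 => // o2 _;
case: (ltgtP 0 (orient (b k) (b i) (b x))) n3 => // o3 _.
- by case: (et.2 x).
- by case: (@beyond_edge_false k i j x).
- by case: (@beyond_edge_false j k i x).
- by constructor 3.
- by case: (@beyond_edge_false i j k x).
- by constructor 1.
- by constructor 2.
- lra.
Qed.

(** From inside the triangle, x is seen after k and before j, on the arc that contains i. *)
Lemma beyond_vertex_signs (A : {set I}) i j k x : tri (b i) (b j) (b k) (r A) ->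
  beyond_vertex i j k x ->
  0 < orient (r A) (b x) (b j) /\ 0 < orient (r A) (b k) (b x).
Proof.
move=> tr [ijx jkx kix].
have jix : 0 < orient (b j) (b i) (b x) by rewrite orient_flip oppr_gt0.
have ikx : 0 < orient (b i) (b k) (b x) by rewrite orient_flip oppr_gt0.
split; rewrite orient_rot; apply: (tri_mean tr).
- by rewrite orient_rot ltW.
- by rewrite (orientpq _ _).2.
- by rewrite orient_rot ltW.
- by rewrite orient_rot jix.
- by rewrite -orient_rot ltW.
- by rewrite -orient_rot ltW.
- by rewrite (orientpq _ _).1.
- by rewrite -orient_rot ikx.
Qed.

Lemma beyond_vertex_between (A : {set I}) i j k x : tri (b i) (b j) (b k)
  (r A) ->
  beyond_vertex i j k x -> sees_between A i j x \/ sees_between A k i x.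
Proof.
move=> tr bx; have [xj kx] := beyond_vertex_signs tr bx.
have nix : i != x.
  by case: bx => + _ _; apply: contraTneq => <-; rewrite (orientpq _ _).1 ltxx.
case: (ltgtP 0 (orient (r A) (b i) (b x))) (genr A nix) => // ix _;
  first by left.
by right; split=> //; rewrite (orient_swap (r A)) oppr_gt0.
Qed.

(** For A = {x, y, w}, each visible point is in one of the two gaps next to its vertex. No gap is
    available to all three, so two gaps are occupied, against [gaps_false]. *)
Lemma three_vertices_false i j k x y w : empty_tri i j k ->
  beyond_vertex i j k x -> beyond_vertex j k i y -> beyond_vertex k i j w ->
    False.
Proof.
move=> et bx yb bw; pose A : {set I} := [set x; y; w]%SET.
have inA u : (u \in A) = (u \in [:: x; y; w]) by rewrite /A !finset.inE orbA.
have [[ix jx kx] [jy ky iy] [kw iw jw]] :=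
  And3 (beyond_vertex_neq bx) (beyond_vertex_neq yb) (beyond_vertex_neq bw).
have iA : i \notin A by rewrite inA !inE !negb_or ix iy iw.
have jA : j \notin A by rewrite inA !inE !negb_or jx jy jw.
have kA : k \notin A by rewrite inA !inE !negb_or kx ky kw.
have [xA yA wA] : [/\ x \in A, y \in A & w \in A]
  by rewrite !inA !inE !eqxx ?orbT.
have tr := inner_tri et iA jA; have tr2 := tri_rot tr; have tr3 := tri_rot tr2.
have et2 := empty_tri_rot et; have et3 := empty_tri_rot et2.
have g1 u v : u \in A -> v \in A -> sees_between A i j u ->
  sees_between A j k v -> False.
  by move=> uA vA; exact: (gaps_false et tr).
have g2 u v : u \in A -> v \in A -> sees_between A j k u ->
  sees_between A k i v -> False.
  by move=> uA vA; exact: (gaps_false et2 tr2).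
have g3 u v : u \in A -> v \in A -> sees_between A k i u ->
  sees_between A i j v -> False.
  by move=> uA vA; exact: (gaps_false et3 tr3).
have [sx|sx] := beyond_vertex_between tr bx;
have [sy|sy] := beyond_vertex_between tr2 yb;
have [sw|sw] := beyond_vertex_between tr3 bw;
  by [exact: g1 sx sy|exact: g1 sx sw|exact: g1 sy sw|exact: g2 sx sy
     |exact: g2 sy sx|exact: g2 sy sw|exact: g2 sw sx|exact: g3 sx sy|
       exact: g3 sw sx|exact: g3 sw sy].
Qed.

(** The blocked k is outside the cone from the visible x to the visible j, hence so are the blocked
    i and y. *)
Lemma same_vertex_view (A : {set I}) i j k x y : empty_tri i j k ->
  tri (b i) (b j) (b k) (r A) -> i \notin A -> k \notin A -> j \in A ->
    x \in A ->
  y \notin A -> beyond_vertex i j k x -> beyond_vertex i j k y ->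
  0 < orient (r A) (b i) (b x) /\ 0 < orient (r A) (b y) (b x).
Proof.
move=> et tr iA kA jA xA yA bx yb.
have [xj kx] := beyond_vertex_signs tr bx;
  have [yj ky] := beyond_vertex_signs tr yb.
have ij : 0 < orient (r A) (b i) (b j) by rewrite orient_rot; case: tr.
have neg u v : 0 < orient (r A) (b u) (b v) -> 0 < orient (r A) (b v) (b u) ->
  False.
  by move=> uv; rewrite (orient_swap (r A)) oppr_gt0 => /(lt_trans uv);
    rewrite ltxx.
have nix : i != x by apply: contraNneq iA => ->.
have nxy : y != x by apply: contraNneq yA => ->.
split.
  case: (ltgtP 0 (orient (r A) (b i) (b x))) (genr A nix) => // ix _.
  have xi : 0 < orient (r A) (b x) (b i)
    by rewrite (orient_swap (r A)) oppr_gt0.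
  have [_ xk _] := inner_key et tr xA jA iA kA (And3 xj xi ij).
  by case: (neg _ _ kx xk).
case: (ltgtP 0 (orient (r A) (b y) (b x))) (genr A nxy) => // yx _.
have xy : 0 < orient (r A) (b x) (b y) by rewrite (orient_swap (r A)) oppr_gt0.
have [_ xk _] := inner_key et tr xA jA yA kA (And3 xj xy yj).
by case: (neg _ _ kx xk).
Qed.

(** The mirror image: the blocked j is outside the cone from k to y, hence so are i and x. *)
Lemma same_vertex_view_sym (A : {set I}) i j k x y : empty_tri i j k ->
  tri (b i) (b j) (b k) (r A) -> i \notin A -> j \notin A -> k \in A ->
    y \in A ->
  x \notin A -> beyond_vertex i j k x -> beyond_vertex i j k y ->
  0 < orient (r A) (b y) (b i) /\ 0 < orient (r A) (b y) (b x).
Proof.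
move=> et tr iA jA kA yA xA bx yb.
have [xj kx] := beyond_vertex_signs tr bx;
  have [yj ky] := beyond_vertex_signs tr yb.
have ki : 0 < orient (r A) (b k) (b i) by rewrite orient_rot; case: tr.
have neg u v : 0 < orient (r A) (b u) (b v) -> 0 < orient (r A) (b v) (b u) ->
  False.
  by move=> uv; rewrite (orient_swap (r A)) oppr_gt0 => /(lt_trans uv);
    rewrite ltxx.
have nyi : y != i by apply: contraNneq iA => <-.
have nyx : y != x by apply: contraNneq xA => <-.
split.
  case: (ltgtP 0 (orient (r A) (b y) (b i))) (genr A nyi) => // yi _.
  have iy : 0 < orient (r A) (b i) (b y)
    by rewrite (orient_swap (r A)) oppr_gt0.
  have [_ _ jy] := inner_key et tr kA yA iA jA (And3 ky ki iy).
  by case: (neg _ _ yj jy).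
case: (ltgtP 0 (orient (r A) (b y) (b x))) (genr A nyx) => // yx _.
have xy : 0 < orient (r A) (b x) (b y) by rewrite (orient_swap (r A)) oppr_gt0.
have [_ _ jy] := inner_key et tr kA yA xA jA (And3 ky kx xy).
by case: (neg _ _ yj jy).
Qed.

Lemma same_vertex_false i j k x y : empty_tri i j k -> x != y ->
  beyond_vertex i j k x -> beyond_vertex i j k y -> False.
Proof.
move=> et; wlog ixy : x y / 0 < orient (b i) (b x) (b y) => [H|] xy bx yb.
  have nixy : orient (b i) (b x) (b y) != 0.
    have [[ix _ _] [iy _ _]] := (beyond_vertex_neq bx, beyond_vertex_neq yb).
    by apply: genb; rewrite /= !inE negb_or ix iy xy.
  case: (ltgtP 0 (orient (b i) (b x) (b y))) nixy => // o _.
    by apply: (H x y).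
  by apply: (H y x) => //; [rewrite orient_swap oppr_gt0|rewrite eq_sym].
have [[ix jx kx] [iy jy ky]] := (beyond_vertex_neq bx, beyond_vertex_neq yb).
(* Two mirrored views: r_A sees x but not y, and r_C sees y but not x. *)
pose A : {set I} := [set j; x]%SET; pose C : {set I} := [set k; y]%SET.
have [z Xz] : X !=set0.
  have iD : i \notin ([set x]%SET : {set I}) by rewrite finset.in_set1.
  by have [t _ Xt] := blk iD; exists (lerp t (r [set x]%SET) (b i)).
have ijk := tri_orient (et.1 _ Xz).
have /= /and3P[] := orient_neq3 ijk;
  rewrite !inE negb_or => /andP[nij nik] njk _.
have [iA [kA yA]] : i \notin A /\ (k \notin A /\ y \notin A).
  by rewrite !finset.in_set2 !negb_or nij ix (eq_sym k j) njk kx (eq_sym y j)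
    jy (eq_sym y x) xy.
have [iC [jC xC]] : i \notin C /\ (j \notin C /\ x \notin C).
  by rewrite !finset.in_set2 !negb_or nik iy njk jy (eq_sym x k) kx xy.
have trA : tri (b i) (b j) (b k) (r A).
  by apply/tri_rot; apply: (inner_tri (empty_tri_rot (empty_tri_rot et)) kA iA).
have trC := inner_tri et iC jC.
have [jA xA] : j \in A /\ x \in A by rewrite !finset.in_set2 !eqxx orbT.
have [kC yC] : k \in C /\ y \in C by rewrite !finset.in_set2 !eqxx orbT.
have [a1 a2] := same_vertex_view et trA iA kA jA xA yA bx yb.
have [c1 c2] := same_vertex_view_sym et trC iC jC kC yC xC bx yb.
case: (bx) (yb) => ijx _ kix [ijy _ kiy].
have ijA : 0 < orient (b i) (b j) (r A) by case: trA.
have ijC : 0 < orient (b i) (b j) (r C) by case: trC.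
have kiC : 0 < orient (b k) (b i) (r C) by case: trC.
set rA := r A in a1 a2 ijA *; set rC := r C in c1 c2 ijC kiC *.
have XE : orient (b i) (b x) rA =
    orient (b i) (b x) (b y) + orient rA (b y) (b x) + orient (b i) (b y) rA.
  by rewrite /orient; ring.
have XE' : orient (b i) (b x) rC =
    orient (b i) (b x) (b y) + orient rC (b y) (b x) - orient rC (b y) (b i).
  by rewrite /orient; ring.
(* The next three signs come from Grassmann-Plücker relations among vectors starting at b_i. *)
rewrite orient_rot in a1.
have Y_gt0 : 0 < orient (b i) (b y) rA.
  rewrite ltNge; apply/negP => Y_le0; have := mulr_le0 Y_le0 (ltW ijx).
  have := mulr_gt0 ixy ijA;
    have : orient (b i) (b x) rA * orient (b i) (b j) (b y) < 0.
    by rewrite pmulr_rlt0.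
  have -> : orient (b i) (b x) (b y) * orient (b i) (b j) rA =
      orient (b i) (b x) rA * orient (b i) (b j) (b y)
      - orient (b i) (b y) rA * orient (b i) (b j) (b x) by rewrite /orient;
        ring.
  lra.
have X'_lt0 : orient (b i) (b x) rC < 0.
  rewrite ltNge; apply/negP => X'_ge0.
  have := mulr_ge0_le0 X'_ge0 (ltW kiy).
  have := mulr_gt0 ixy kiC;
    have : orient rC (b y) (b i) * orient (b k) (b i) (b x) < 0.
    by rewrite pmulr_rlt0.
  have -> : orient (b i) (b x) (b y) * orient (b k) (b i) rC =
      orient (b i) (b x) rC * orient (b k) (b i) (b y)
      + orient rC (b y) (b i) * orient (b k) (b i) (b x) by rewrite /orient;
        ring.
  lra.
have rs_gt0 : 0 < orient (b i) rA rC.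
  rewrite ltNge; apply/negP => rs_le0; have := mulr_le0 rs_le0 (ltW ijx).
  have := mulr_gt0 a1 ijC; have : orient (b i) (b x) rC * orient (b i) (b j)
    rA < 0.
    by rewrite nmulr_rlt0.
  have -> : orient (b i) rA rC * orient (b i) (b j) (b x) =
      orient (b i) (b x) rC * orient (b i) (b j) rA
      - orient (b i) (b x) rA * orient (b i) (b j) rC by rewrite /orient; ring.
  lra.
(* One more such relation: after [XE] and [XE'] are substituted, a positive product equals minus a
   sum of positive ones. *)
have := mulr_gt0 ixy rs_gt0; have := mulr_gt0 c1 ixy; have := mulr_gt0 c1 a2.
have := mulr_gt0 ixy Y_gt0; have := mulr_gt0 c2 Y_gt0.
have -> : orient (b i) (b x) (b y) * orient (b i) rA rC =
   - (orient (b i) (b x) rA * orient rC (b y) (b i))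
   - orient (b i) (b x) rC * orient (b i) (b y) rA by rewrite /orient; ring.
rewrite XE XE'; lra.
Qed.

(** At least three blue points are outside the vertices of an empty triangle: two share an opposite
    region, or there is one in each. *)
Lemma inner_false i j k : (5 < #|I|)%N ->
  (forall z, X z -> tri (b i) (b j) (b k) z) -> False.
Proof.
move=> I6 Xt; have X0 : X !=set0.
  have i0 : i \notin (finset.set0 : {set I}) by rewrite finset.in_set0.
  by have [t _ Xz] := blk i0; exists (lerp t (r finset.set0) (b i)).
have [i' [j' [k' et]]] := empty_triangle X0 Xt.
move: {i j k Xt} i' j' k' et => i j k et.
have /card_gt2P[x [y [w [[xS yS wS] [xy yw wx]]]]] :
  (2 < #|~: [set i; j; k]%SET|)%N.
  have := cardsC ([set i; j; k]%SET : {set I}).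
  have : (#|[set i; j; k]%SET : {set I}| <= 3)%N.
    apply: leq_trans (leq_card_setU _ _) _; rewrite cards1 addn1 ltnS.
    by apply: leq_trans (leq_card_setU _ _) _; rewrite !cards1.
  move=> c3 cE; rewrite -cE in I6.
  by rewrite -(ltn_add2l 3); apply: leq_trans I6 _; rewrite leq_add2r.
have out q : q \in ~: [set i; j; k]%SET ->
  [\/ beyond_vertex i j k q, beyond_vertex j k i q | beyond_vertex k i j q].
  rewrite finset.in_setC !finset.inE => qS;
    apply: empty_tri_beyond_vertex => //.
  by rewrite !inE orbA.
have et2 := empty_tri_rot et; have et3 := empty_tri_rot et2.
have wx' : x != w by rewrite eq_sym.
have [bx|bx|bx] := out x xS; have [yb|yb|yb] := out y yS;
  have [bw|bw|bw] := out w wS;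
  first [exact: (same_vertex_false et xy)|exact: (same_vertex_false et2 xy)
  |exact: (same_vertex_false et3 xy)|exact: (same_vertex_false et yw)
  |exact: (same_vertex_false et2 yw)|exact: (same_vertex_false et3 yw)
  |exact: (same_vertex_false et wx')|exact: (same_vertex_false et2 wx')
  |exact: (same_vertex_false et3 wx')|exact: (three_vertices_false et bx yb bw)
  |exact: (three_vertices_false et bx bw yb)
  |exact: (three_vertices_false et yb bx bw)
  |exact: (three_vertices_false et yb bw bx)
  |exact: (three_vertices_false et bw bx yb)
  |exact: (three_vertices_false et bw yb bx)].
Qed.

(** * An obstacle outside all triangles of blue points *)

Hypothesis outer : forall i j k z, X z -> ~ tri (b i) (b j) (b k) z.

(** The three cones at an inner point r_A cover the direction of p. Wherever the blocking point is
    on the segment to p, it is in a blue triangle or on a blue edge. *)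
Lemma outer_not_tri (A : {set I}) p i j k : p \notin A ->
  ~ tri (b i) (b j) (b k) (r A).
Proof.
move=> pA; have [t t01 Xt] := blk pA.
have corner i' j' k' : tri (b i') (b j') (b k') (r A) -> p != i'.
  by move=> tr; apply/eqP => E; apply: (outer Xt); rewrite E;
    exact: tri_lerp tr t01.
have cn i' j' k' : tri (b i') (b j') (b k') (r A) ->
  ~ cone (r A) (b i') (b j') (b p).
  move=> tr c; have [tz|sz|tz] := cone_lerp c t01.
  - exact: (outer Xt) (tri_sub tr tz).
  - have ij : i' != j' by apply: (@orient_neq (r A)); case: c => c _ _;
    rewrite gt_eqF.
    exact: (bb ij sz).
  - exact: (outer Xt) tz.
move=> tr; have tr2 := tri_rot tr; have tr3 := tri_rot tr2.
have pr i' j' k' : tri (b i') (b j') (b k') (r A) ->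
  orient (r A) (b i') (b p) != 0.
  by move=> tr'; apply: genr; rewrite eq_sym; exact: corner tr'.
by have [||] := cone_of_tri tr (pr _ _ _ tr) (pr _ _ _ tr2) (pr _ _ _ tr3);
  [exact: cn tr|exact: cn tr2|exact: cn tr3].
Qed.

Lemma outer_tri (A : {set I}) j k p : j \in A -> k \in A -> p \notin A ->
  cone (r A) (b j) (b k) (b p) -> forall z, X z -> tri (r A) (b j) (b k) z.
Proof.
move=> jA kA pA c; apply: (@outer_cone _ X _ _ _ (b p)) => //; try exact: vis.
- by apply: bb; apply: (@orient_neq (r A)); case: c => c _ _; rewrite gt_eqF.
- by move=> z Xz; exact: outer.
- exact: blk.
Qed.

Lemma outer_key (A : {set I}) j k p q : j \in A -> k \in A -> p \notin A ->
  q \notin A -> cone (r A) (b j) (b k) (b p) -> cone (r A) (b j) (b k) (b q).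
Proof.
by move=> jA kA pA qA c; apply: (tri_cone_meets (outer_tri jA kA pA c));
  exact: blk.
Qed.

(** The sign is a factor e, so that both sides can be treated at once and compared by
    [crossing_signs]. *)
Definition one_side (q p : R * R) : Prop :=
  exists e : R, (e = 1 \/ e = -1) /\ forall z, X z -> 0 < e * orient q p z.

(* All blocked points are between two consecutive visible ones, which confines X
   to the triangle spanned by these two and [r A]. *)
Lemma one_side_sorted (A : {set I}) j l k p :
  j \in A -> l \in A -> k \in A -> p \notin A ->
  0 < orient (r A) (b j) (b l) -> 0 < orient (r A) (b l) (b k) ->
  0 < orient (r A) (b j) (b k) ->
  tri (b j) (b l) (b k) (b p) \/ tri (b k) (b l) (b j) (b p) ->
  [/\ one_side (r A) (b j), one_side (r A) (b l) & one_side (r A) (b k)].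
Proof.
move=> jA lA kA pA jl lk jk tp; have [jp pk] := tri_cone jl lk jk tp.
have kj : orient (r A) (b k) (b j) < 0 by rewrite orient_swap oppr_lt0.
have kl : orient (r A) (b k) (b l) < 0 by rewrite orient_swap oppr_lt0.
have lp : orient (r A) (b l) (b p) != 0.
  by apply: genr; apply: contraNneq pA => <-.
have pos i : (forall z, X z -> 0 < orient (r A) (b i) z) ->
  one_side (r A) (b i).
  by move=> H; exists 1; split=> [|z /H]; [left|rewrite mul1r].
have neg i : (forall z, X z -> orient (r A) (b i) z < 0) ->
  one_side (r A) (b i).
  by move=> H; exists (-1); split=> [|z /H]; [right|rewrite mulN1r oppr_gt0].
(* The ray through l cuts the cone of j and k in two, and p is in one of the halves. *)
case: (ltgtP 0 (orient (r A) (b l) (b p))) lp => // lp _.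
- have T := outer_tri lA kA pA (And3 lk lp pk).
  split; [apply: pos|apply: pos|apply: neg] => z /T [lz lkz kz] //.
  + rewrite -(pmulr_rgt0 _ lk) orient_bary.
    by rewrite (orientpq (r A) (b j)).1 mulr0 add0r addr_gt0// mulr_gt0.
  + by rewrite -oppr_gt0 -orient_flip.
- have pl : 0 < orient (r A) (b p) (b l) by rewrite orient_swap oppr_gt0.
  have T := outer_tri jA lA pA (And3 jl jp pl).
  split; [apply: pos|apply: neg|apply: neg] => z /T [jz jlz lz] //.
  + by rewrite -oppr_gt0 -orient_flip.
  + rewrite -(pmulr_rlt0 _ jl) orient_bary.
    rewrite (orientpq (r A) (b k)).1 mulr0 add0r -oppr_gt0 opprD -!mulrN.
    by rewrite addr_gt0// mulr_gt0// oppr_gt0.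
Qed.

(** Cyclic views of j, k, l would put r_A in a blue triangle; the six other sign patterns are linear
    orders, handled by [one_side_sorted]. *)
Lemma visible_one_side (A : {set I}) j k l p : uniq [:: j; k; l] ->
  j \in A -> k \in A -> l \in A -> p \notin A ->
  tri (b j) (b k) (b l) (b p) \/ tri (b l) (b k) (b j) (b p) ->
  one_side (r A) (b j).
Proof.
rewrite /= !inE negb_or andbT => /andP[/andP[njk njl] nkl] jA kA lA pA tp.
have rot x y z : tri (b x) (b y) (b z) (b p) \/ tri (b z) (b y) (b x) (b p) ->
    tri (b y) (b z) (b x) (b p) \/ tri (b x) (b z) (b y) (b p).
  by case=> [/tri_rot|/tri_rot/tri_rot]; [left|right].
have sym x y z : tri (b x) (b y) (b z) (b p) \/ tri (b z) (b y) (b x) (b p) ->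
    tri (b z) (b y) (b x) (b p) \/ tri (b x) (b y) (b z) (b p).
  by case; [right|left].
have out1 := @outer_not_tri A p j k l pA;
  have out2 := @outer_not_tri A p l k j pA.
have swap x y : orient (r A) (b x) (b y) < 0 -> 0 < orient (r A) (b y) (b x).
  by rewrite (orient_swap _ (b y)) oppr_gt0.
have nlj : l != j by rewrite eq_sym.
case: (ltgtP 0 (orient (r A) (b j) (b k))) (genr A njk) => // jk _;
case: (ltgtP 0 (orient (r A) (b k) (b l))) (genr A nkl) => // kl _;
case: (ltgtP 0 (orient (r A) (b l) (b j))) (genr A nlj) => // lj _.
- by case: out1; split; rewrite -orient_rot.
- by have [] := @one_side_sorted A j k l p jA kA lA pA jk kl (swap _ _ lj) tp.
- by have [] := @one_side_sorted A l j k p lA jA kA pA lj jk (swap _ _ kl)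
  (rot _ _ _ (rot _ _ _ tp)).
- by have [] := @one_side_sorted A j l k p jA lA kA pA (swap _ _ lj)
  (swap _ _ kl) jk (sym _ _ _ (rot _ _ _ tp)).
- by have [] := @one_side_sorted A k l j p kA lA jA pA kl lj (swap _ _ jk)
  (rot _ _ _ tp).
- by have [] := @one_side_sorted A k j l p kA jA lA pA (swap _ _ jk)
  (swap _ _ lj) kl (rot _ _ _ (sym _ _ _ tp)).
- by have [] := @one_side_sorted A l k j p lA kA jA pA (swap _ _ kl)
  (swap _ _ jk) lj (sym _ _ _ tp).
- by case: out2; split; rewrite -orient_rot; exact: swap.
Qed.

Definition side_label (x : I * I * I) : bool :=
  let: (i, j, k) := x in
  `[< forall z, X z -> 0 < orient (r [set i; j; k]%SET) (b i) z >].

Arguments side_label : simpl never.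

Definition encloses p (x : I * I * I) : Prop :=
  let: (i, j, k) := x in
  tri (b i) (b j) (b k) (b p) \/ tri (b k) (b j) (b i) (b p).

(** The point of each triangle is blocked from the marked vertex of the other. With equal sides, X
    would cross the segment b_i b_i' by [crossing_signs]. *)
Lemma side_label_neq p i j k i' j' k' :
  uniq [:: p; i; j; k] -> uniq [:: p; i'; j'; k'] ->
  encloses p (i, j, k) -> encloses p (i', j', k') ->
  i \notin [:: i'; j'; k'] -> i' \notin [:: i; j; k] ->
  side_label (i, j, k) != side_label (i', j', k').
Proof.
move=> /= /andP[pijk uijk] /andP[pijk' uijk'] e1 e2 ni ni'.
set A := [set i; j; k]%SET; set A' := [set i'; j'; k']%SET.
have AE x : (x \in A) = (x \in [:: i; j; k]) by rewrite /A !inE orbA.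
have AE' x : (x \in A') = (x \in [:: i'; j'; k']) by rewrite /A' !inE orbA.
have [e [e1' He]] : one_side (r A) (b i).
  by apply: (@visible_one_side A i j k p) => //; rewrite AE// !inE eqxx ?orbT.
have [f [f1' Hf]] : one_side (r A') (b i').
  by apply: (@visible_one_side A' i' j' k' p) => //;
    rewrite AE'// !inE eqxx ?orbT.
have hi : meets X (r A') (b i) by apply: blk; rewrite AE'.
have hi' : meets X (r A) (b i') by apply: blk; rewrite AE.
have [t _ Xt] := hi.
have labE x y z (g : R) : g = 1 \/ g = -1 ->
    (forall u, X u -> 0 < g * orient (r [set x; y; z]%SET) (b x) u) ->
    side_label (x, y, z) = (g == 1).
  case=> -> H; rewrite /side_label.
    by rewrite eqxx; apply/asboolP => u /H; rewrite mul1r.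
  rewrite lt_eqF ?(lt_trans _ ltr01) ?ltrN10//;
    apply/negbTE/asboolP => /(_ _ Xt).
  by have := H _ Xt; rewrite mulN1r oppr_gt0 => /lt_trans /[apply];
    rewrite ltxx.
rewrite (labE i j k e)// (labE i' j' k' f)//; apply/negP => /eqP ef.
have fe : f = e.
  by case: e1' f1' ef => -> [] -> //; rewrite eqxx; [move/esym|] => /eqP.
rewrite fe in Hf; apply: (@crossing_signs _ X (r A) (r A') (b i) (b i') e) =>
  //.
by apply: bb; apply: contra ni => /eqP ->; rewrite inE eqxx.
Qed.
End Shattering.

Lemma increasing3P n i j k : (i, j, k) \in increasing3 n ->
  [&& (i < j)%N, (j < k)%N & (k < n)%N].
Proof.
move=> /allpairsPdep[[x y] [k' [xy yk [-> -> ->]]]].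
have /allpairsPdep[y' [x' [y'n x'y' [ex ey]]]] := xy; subst x' y'.
move: y'n x'y' yk; rewrite !mem_iota /= => yn x'y' /andP[yk].
rewrite subnKC// => ->.
by rewrite x'y' yk.
Qed.

(** * Six blue points: odd conflict walks and the convex hexagon *)

Section SixPoints.
Variables (R : realType) (X : set (R * R)).
Variables (b : 'I_6 -> R * R) (r : {set 'I_6} -> R * R).
Hypothesis cX : connected X.
Hypothesis bb : forall i j, i != j -> misses X (b i) (b j).
Hypothesis vis : forall (A : {set 'I_6}) i, i \in A -> misses X (r A) (b i).
Hypothesis blk : forall (A : {set 'I_6}) i, i \notin A -> meets X (r A) (b i).
Hypothesis genb : forall i j k, uniq [:: i; j; k] ->
  orient (b i) (b j) (b k) != 0.
Hypothesis genr : forall A i j, i != j -> orient (r A) (b i) (b j) != 0.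
Hypothesis outer : forall i j k z, X z -> ~ tri (b i) (b j) (b k) z.

(** The view from r_A, with A every other vertex, is turned into a tournament satisfying the three
    conditions that [hexagon_all] shows incompatible. *)
Lemma hexagon_false (v : nat -> 'I_6) :
  (forall i j, (i < 6)%N -> (j < 6)%N -> i != j -> v i != v j) ->
  (forall i j k, (i < j)%N -> (j < k)%N -> (k < 6)%N ->
    0 < orient (b (v i)) (b (v j)) (b (v k))) ->
  False.
Proof.
move=> vI conv; pose A : {set 'I_6} := [set v 0%N; v 2; v 4]%SET.
have inA i : i \in [:: 0; 2; 4]%N -> v i \in A.
  by rewrite !inE => /or3P[] /eqP ->; rewrite eqxx ?orbT.
have notA i : i \in [:: 1; 3; 5]%N -> v i \notin A.
  by rewrite !inE => /or3P[] /eqP ->; rewrite !negb_or !vI.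
pose t : rel nat := fun i j => 0 < orient (r A) (b (v i)) (b (v j)).
pose t' := tournament_of 6 (code_tournament 6 t).
have anti i j : (i < 6)%N -> (j < 6)%N -> i != j -> t j i = ~~ t i j.
  by move=> i6 j6 ij; apply: orient_tournament; apply: genr; exact: vI.
have t'E i j : (i < 6)%N -> (j < 6)%N -> i != j -> t' i j = t i j.
  by move=> i6 j6 ij; apply: tournament6_ofK => //; exact: anti.
have chk : hexagon_check t'.
  apply: (all_bitsP hexagon_all).
  by [].
move: chk; rewrite /hexagon_check ifT; last first.
  apply/allP => -[[i j] k] /increasing3P /and3P[ij jk k6] /=.
  have [j6 ik] := (ltn_trans jk k6, ltn_trans ij jk).
  have i6 := ltn_trans ij j6.
  have [nij njk nki] : [/\ i != j, j != k & k != i]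
    by rewrite (ltn_eqF ij) (ltn_eqF jk) (gtn_eqF ik).
  rewrite /cyc3 !t'E//.
  apply/negP => /andP[/eqP e1 /eqP e2].
  have out := @outer_not_tri _ _ _ _ _ bb blk genr outer A (v 1%N).
  have [tij|tij] := boolP (t i j).
    apply: (out (v i) (v j) (v k)); first exact: notA.
    have tjk : t j k by rewrite -e1.
    have tki : t k i by rewrite -e2.
    by split; rewrite -orient_rot.
  apply: (out (v k) (v j) (v i)); first exact: notA.
  have tji : t j i by rewrite anti// ltn_eqF.
  have tkj : t k j by rewrite anti// -?e1// ltn_eqF.
  have tik : t i k by rewrite anti// -?e2 -?e1// gtn_eqF.
  by split; rewrite -orient_rot.
move=> /negP; apply; apply/andP; split.
  apply/allP => -[[i j] k] /increasing3P /and3P[ij jk k6].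
  apply/allP => l; rewrite mem_iota => /= l6.
  case: leqP => //= kl; rewrite -!negb_and.
  have [j6 ik] := (ltn_trans jk k6, ltn_trans ij jk).
  have i6 := ltn_trans ij j6.
  have [il jl] := (ltn_trans ik kl, ltn_trans jk kl).
  have [nij nil nkj nkl] : [/\ i != j, i != l, k != j & k != l].
    by rewrite (ltn_eqF ij) (ltn_eqF il) (gtn_eqF jk) (ltn_eqF kl).
  rewrite !t'E//.
  apply/negP => /and3P[/eqP e1 /eqP e2 /eqP e3].
  (* With crossing diagonals on different sides, the four terms of this vanishing sum would have the
     same sign. *)
  have E := orient_crossing (r A) (b (v i)) (b (v j)) (b (v k)) (b (v l)).
  have c1 := conv _ _ _ jk kl l6; have c2 := conv _ _ _ ik kl l6.
  have c3 := conv _ _ _ ij jk k6; have c4 := conv _ _ _ ij jl l6.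
  have [tij|tij] := boolP (t i j).
    have til : t i l by rewrite -e1.
    have tkj : t k j by rewrite -e2.
    have tkl : t k l by rewrite -e3.
    suff : 0 < (0 : R) by rewrite ltxx.
    by rewrite -[X in _ < X]E !addr_gt0// !mulr_gt0.
  have tji : t j i by rewrite anti// ltn_eqF.
  have tli : t l i by rewrite anti// -?e1// ltn_eqF.
  have tjk : t j k by rewrite anti// -?e2 -?e1// gtn_eqF.
  have tlk : t l k by rewrite anti// -?e3 -?e2 -?e1// ltn_eqF.
  suff : (0 : R) < 0 by rewrite ltxx.
  rewrite -[X in X < _]E -oppr_gt0 !opprD -!mulrN -!(orient_swap (r A)).
  by rewrite !addr_gt0// !mulr_gt0.
have key j k p q : j \in [:: 0; 2; 4]%N -> k \in [:: 0; 2; 4]%N -> j != k ->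
    p \in [:: 1; 3; 5]%N -> q \in [:: 1; 3; 5]%N ->
    in_cone_rel t' j k p -> in_cone_rel t' j k q.
  move=> jA kA jk pA qA.
  have lt6 i : i \in [:: 0; 2; 4; 1; 3; 5]%N -> (i < 6)%N.
    by rewrite !inE => /or4P[||| /or3P[]] /eqP ->.
  have ne x y : x \in [:: 0; 2; 4]%N -> y \in [:: 1; 3; 5]%N -> x != y.
    by rewrite !inE => /or3P[] /eqP -> /or3P[] /eqP ->.
  have j6 : (j < 6)%N by apply: lt6; rewrite (mem_cat j [:: 0; 2; 4]%N) jA.
  have k6 : (k < 6)%N by apply: lt6; rewrite (mem_cat k [:: 0; 2; 4]%N) kA.
  have p6 : (p < 6)%N by apply: lt6; rewrite (mem_cat p [:: 0; 2; 4]%N) pA orbT.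
  have q6 : (q < 6)%N by apply: lt6; rewrite (mem_cat q [:: 0; 2; 4]%N) qA orbT.
  have [jp jq kp kq] := And4 (ne _ _ jA pA) (ne _ _ jA qA) (ne _ _ kA pA)
    (ne _ _ kA qA).
  have kj : k != j by rewrite eq_sym.
  have pj : p != j by rewrite eq_sym.
  have pk : p != k by rewrite eq_sym.
  have qj : q != j by rewrite eq_sym.
  have qk : q != k by rewrite eq_sym.
  rewrite /in_cone_rel !t'E// => /andP[/eqP e1 /eqP e2].
  have oc := outer_key cX bb vis blk outer.
  have [tjk|tjk] := boolP (t j k).
    have tjp : t j p by rewrite -e1.
    have tpk : t p k by rewrite -e2.
    have [_ q1 q2] := oc A _ _ _ _ (inA _ jA) (inA _ kA) (notA _ pA)
      (notA _ qA) (And3 tjk tjp tpk).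
    have tjq : t j q := q1.
    have tqk : t q k := q2.
    by rewrite tjq tqk.
  have tkj : t k j by rewrite anti.
  have tkp : t k p by rewrite anti// -e2 -e1.
  have tpj : t p j by rewrite anti// -e1.
  have [_ q1 q2] := oc A _ _ _ _ (inA _ kA) (inA _ jA) (notA _ pA) (notA _ qA)
    (And3 tkj tkp tpj).
  have tkq : t k q := q1.
  have tqj : t q j := q2.
  rewrite anti// in tkq; rewrite anti// in tqj.
  by rewrite (negbTE tkq) (negbTE tqj).
apply/allP => -[j k] jk; apply/allP => -[p q] pq.
have [jA kA njk] : [/\ j \in [:: 0; 2; 4]%N, k \in [:: 0; 2; 4]%N & j != k].
  by move: jk; rewrite !inE !xpair_eqE => /or3P[] /andP[/eqP -> /eqP ->].
have [pA qA] : p \in [:: 1; 3; 5]%N /\ q \in [:: 1; 3; 5]%N.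
  by move: pq; rewrite !inE !xpair_eqE => /orP[] /andP[/eqP -> /eqP ->].
by apply/eqP; apply/idP/idP; exact: key.
Qed.

Let other (p : 'I_6) (u : nat) : 'I_6 := lift p (inord u : 'I_5).

Lemma other_neq p u v : (u < 5)%N -> (v < 5)%N -> u != v ->
  other p u != other p v.
Proof.
move=> u5 v5; apply: contra_neq => /lift_inj /(congr1 val) /=.
by rewrite !inordK.
Qed.

Lemma convex_position_sorted p :
  (forall i j k q, ~ tri (b i) (b j) (b k) (b q)) ->
  (exists s : seq nat, [/\ perm_eq s (iota 0 5) & pairwise
    (fun u v => 0 < orient (b p) (b (other p u)) (b (other p v))) s]) -> False.
Proof.
move=> nc [s [ps /(pairwiseP 0%N)]]; rewrite (perm_size ps) size_iota => srt.
pose v n := if n is u.+1 then other p (nth 0%N s u) else p.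
have s5 u : (u < 5)%N -> (nth 0%N s u < 5)%N.
  move=> u5; have : nth 0%N s u \in s
    by rewrite mem_nth// (perm_size ps) size_iota.
  by rewrite (perm_mem ps) mem_iota.
have us : uniq s by rewrite (perm_uniq ps) iota_uniq.
have vI i j : (i < 6)%N -> (j < 6)%N -> i != j -> v i != v j.
  case: i j => [|i] [|j] //= i6 j6 ij; first exact: neq_lift.
    by rewrite eq_sym; exact: neq_lift.
  apply: other_neq; rewrite ?s5//.
  by rewrite nth_uniq// (perm_size ps) size_iota.
have v0 i j : (i < j)%N -> (j < 5)%N ->
  0 < orient (b p) (b (v i.+1)) (b (v j.+1)).
  by move=> ij j5; apply: srt => //; exact: ltn_trans j5.
apply: (@hexagon_false v) => // -[|i] [|j] [|k] // ij jk k6; first exact: v0.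
have [ij' jk' k5] : [/\ (i < j)%N, (j < k)%N & (k < 5)%N] by [].
have ik' := ltn_trans ij' jk'; have j5 := ltn_trans jk' k5.
have [ij5 jk5 ik5] := And3 (v0 _ _ ij' j5) (v0 _ _ jk' k5) (v0 _ _ ik' k5).
have n0 : orient (b (v i.+1)) (b (v j.+1)) (b (v k.+1)) != 0.
  have nij : v i.+1 != v j.+1 by apply: vI;
    rewrite ?eqSS ?ltnS ?(ltn_eqF ij')//; exact: ltn_trans j5.
  have njk : v j.+1 != v k.+1 by apply: vI; rewrite ?eqSS ?ltnS ?(ltn_eqF jk').
  have nik : v i.+1 != v k.+1.
    by apply: vI; rewrite ?eqSS ?ltnS ?(ltn_eqF ik')//; exact: ltn_trans j5.
  by apply: genb; rewrite !cons_uniq !inE negb_or nij njk nik.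
(* A clockwise triple would put the middle point inside the triangle of p and the two others. *)
case: (ltgtP 0 (orient (b (v i.+1)) (b (v j.+1)) (b (v k.+1)))) n0 => // neg _.
case: (nc p (v i.+1) (v k.+1) (v j.+1)); split=> //.
- by rewrite orient_swap oppr_gt0.
- by rewrite orient_rot.
Qed.

(** By [side_label_neq], the side labels properly 2-color the conflicts around p. *)
Lemma no_conflict_walk p
  (t := fun u v => 0 < orient (b p) (b (other p u)) (b (other p v)))
    (l : seq (nat * nat * nat)) :
  ~~ odd_conflict_walk 5 (tournament_of 5 (code_tournament 5 t)) l.
Proof.
set t' := tournament_of _ _.
have t'E i j : (i < 5)%N -> (j < 5)%N -> i != j -> t' i j = t i j.
  move=> i5 j5 ij; apply: tournament5_ofK => //; apply: orient_tournament.
  by apply: genb; rewrite /= !inE negb_or !neq_lift /= andbT; exact: other_neq.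
apply/negP => /and3P[odd_l cyc_l /allP wf_l].
have enc i j k : wf_triple 5 (i, j, k) -> cyc3 t' i j k ->
    encloses b p (other p i, other p j, other p k).
  move=> /and4P[/= /and3P[nij njk _] i5 j5 k5].
  move: nij; rewrite !inE negb_or => /andP[nij nik].
  have nki : k != i by rewrite eq_sym.
  rewrite inE in njk; rewrite /cyc3 !t'E// => /andP[/eqP e1 /eqP e2].
  have anti x y : (x < 5)%N -> (y < 5)%N -> x != y -> t y x = ~~ t x y.
    move=> x5 y5 xy; apply: orient_tournament.
    by apply: genb; rewrite /= !inE negb_or !neq_lift /= andbT;
      exact: other_neq.
  have [tij|tij] := boolP (t i j).
    have tjk : t j k by rewrite -e1.
    have tki : t k i by rewrite -e2.
    by left; split; rewrite -orient_rot.
  have tji : t j i by rewrite anti.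
  have tkj : t k j by rewrite anti// -e1.
  have tik : t i k by rewrite anti// -e2 -e1.
  by right; split; rewrite -orient_rot.
have otheri x (s : seq nat) : (x < 5)%N -> all (fun y => (y < 5)%N) s ->
  x \notin s ->
    other p x \notin map (other p) s.
  move=> x5 /allP s5; apply: contra => /mapP[y ys]; have y5 := s5 _ ys.
  by apply: contra_eqT => xy; rewrite other_neq//; apply: contraNneq xy => ->.
pose c x := let: (i, j, k) := x in
  side_label X b r (other p i, other p j, other p k).
move: odd_l; apply/negP; apply: (odd_cycle_coloring (c := c)) cyc_l => /=.
move=> [[i j] k] [[i' j'] k'] /wf_l w /wf_l w' /and4P[c1 c2 n1 n2].
rewrite /c; have := enc _ _ _ w c1; have := enc _ _ _ w' c2 => E' E.
move: w w' => /and4P[u i5 j5 k5] /and4P[u' i5' j5' k5'].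
have up x y z : uniq [:: x; y; z] -> (x < 5)%N -> (y < 5)%N -> (z < 5)%N ->
    uniq [:: p; other p x; other p y; other p z].
  rewrite /= !inE !negb_or !andbT => /andP[/andP[xy xz] yz] x5 y5 z5.
  by rewrite !neq_lift !other_neq.
apply: (side_label_neq cX bb vis blk genr outer (p := p)) => //.
- exact: up.
- exact: up.
- by apply: (otheri i [:: i'; j'; k']) => //=; rewrite i5' j5' k5'.
- by apply: (otheri i' [:: i; j; k]) => //=; rewrite i5 j5 k5.
Qed.

(** For j, k, l on one side of the ray to i and cyclic around p, the three terms of the
    Grassmann-Plücker relation would have the same sign. *)
Lemma orient_locally_transitive p
    (t := fun u v => 0 < orient (b p) (b (other p u)) (b (other p v))) :
  locally_transitive 5 (tournament_of 5 (code_tournament 5 t)).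
Proof.
set t' := tournament_of _ _.
have anti x y : (x < 5)%N -> (y < 5)%N -> x != y -> t y x = ~~ t x y.
  move=> x5 y5 xy; apply: orient_tournament.
  by apply: genb; rewrite /= !inE negb_or !neq_lift /= andbT; exact: other_neq.
have t'E i j : (i < 5)%N -> (j < 5)%N -> i != j -> t' i j = t i j.
  by move=> i5 j5 ij; apply: tournament5_ofK => //; exact: anti.
apply/allP => i; rewrite mem_iota => /andP[_ i5].
apply/allP => -[[j k] l] /increasing3P /and3P[jk kl l5].
have [//|] := boolP (i \in [:: j; k; l]).
rewrite !inE !negb_or => /and3P[ij ik il].
have [k5 jl] := (ltn_trans kl l5, ltn_trans jk kl); have j5 := ltn_trans jk k5.
have [njk nkl nlj] : [/\ j != k, k != l & l != j].
  by rewrite (ltn_eqF jk) (ltn_eqF kl) (gtn_eqF jl).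
rewrite /cyc3 !t'E// -!negb_and; apply/negP.
move=> /and3P[/eqP e1 /eqP e2 /andP[/eqP e3 /eqP e4]].
have E := orient_gp (b p) (b (other p i)) (b (other p j)) (b (other p k))
  (b (other p l)).
rewrite (orient_swap (b p) (b (other p j)) (b (other p l))) mulrN opprK in E.
have neg x y : (x < 5)%N -> (y < 5)%N -> x != y -> ~~ t x y ->
    0 < - orient (b p) (b (other p x)) (b (other p y)).
  by move=> x5 y5 xy; rewrite -anti// /t orient_swap.
have [tij|tij] := boolP (t i j).
- have tik : t i k by rewrite -e1.
  have til : t i l by rewrite -e2.
  have [tjk|tjk] := boolP (t j k).
  + have tkl : t k l by rewrite -e3.
    have tlj : t l j by rewrite -e4.
    have := mulr_gt0 tij tkl; have := mulr_gt0 tik tlj;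
      have := mulr_gt0 til tjk.
    lra.
  + have tkl : ~~ t k l by rewrite -e3.
    have tlj : ~~ t l j by rewrite -e4.
    have := mulr_gt0 tij (neg _ _ k5 l5 nkl tkl).
    have := mulr_gt0 tik (neg _ _ l5 j5 nlj tlj).
    have := mulr_gt0 til (neg _ _ j5 k5 njk tjk).
    lra.
- have tik : ~~ t i k by rewrite -e1.
  have til : ~~ t i l by rewrite -e2.
  have pij := neg _ _ i5 j5 ij tij.
  have pik := neg _ _ i5 k5 ik tik.
  have pil := neg _ _ i5 l5 il til.
  have [tjk|tjk] := boolP (t j k).
  + have tkl : t k l by rewrite -e3.
    have tlj : t l j by rewrite -e4.
    have := mulr_gt0 pij tkl; have := mulr_gt0 pik tlj;
      have := mulr_gt0 pil tjk.
    lra.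
  + have tkl : ~~ t k l by rewrite -e3.
    have tlj : ~~ t l j by rewrite -e4.
    have := mulr_gt0 pij (neg _ _ k5 l5 nkl tkl).
    have := mulr_gt0 pik (neg _ _ l5 j5 nlj tlj).
    have := mulr_gt0 pil (neg _ _ j5 k5 njk tjk).
    lra.
Qed.

(** Since odd walks are excluded, the check leaves a sorted tournament without cyclic triples around
    every blue point: none is inside a triangle, and the hexagon is convex. *)
Lemma outer_false : False.
Proof.
have chk p (t := fun u v => 0 < orient (b p) (b (other p u)) (b (other p v))) :
    tournament5_check (tournament_of 5 (code_tournament 5 t)).
  by apply: (all_bitsP tournament5_all).
have cyc0 p (t := fun u v => 0 < orient (b p) (b (other p u)) (b (other p v)))
    (t' := tournament_of 5 (code_tournament 5 t)) :
  ~~ has (fun x => [&& uniq [:: x.1.1; x.1.2; x.2] & cyc3 t' x.1.1 x.1.2 x.2])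
           (triples 5) /\ exists2 s,
             s \in permutations (iota 0 5) & pairwise t' s.
  have := chk p; rewrite /tournament5_check orient_locally_transitive -has_find.
  case: ifP => [_ /hasP[s _ /hasP[l _]]|/negbT ? /hasP[s ss sp]];
    last by split=> //; exists s.
  by move/negP: (no_conflict_walk p l).
have t'E p (t := fun u v => 0 < orient (b p) (b (other p u)) (b (other p v)))
    (t' := tournament_of 5 (code_tournament 5 t)) i j :
  (i < 5)%N -> (j < 5)%N -> i != j -> t' i j = t i j.
  move=> i5 j5 ij; apply: tournament5_ofK => //; apply: orient_tournament.
  by apply: genb; rewrite /= !inE negb_or !neq_lift /= andbT; exact: other_neq.
apply: (@convex_position_sorted ord0) => [i j k q tq|].
  have [/hasPn nocyc _] := cyc0 q.
  have ijk := tri_orient tq.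
  have otherK i' : i' != q -> exists2 u, (u < 5)%N & other q u = i'.
    move=> iq; case: (unliftP q i') iq => [u ->|->]; last by rewrite eqxx.
    by exists u => //; rewrite /other inord_val.
  have [[q1 q2 q3]] : [/\ i != q, j != q & k != q].
    case: tq => iq jq kq; split; apply/eqP => E; move: iq jq kq; rewrite E.
    - by rewrite (orientpq (b q) (b j)).1 ltxx.
    - by rewrite (orientpq (b i) (b q)).2 ltxx.
    - by move=> _; rewrite (orientpq (b j) (b q)).2 ltxx.
  have [u u5 uE] := otherK _ q1; have [v v5 vE] := otherK _ q2.
  have [w w5 wE] := otherK _ q3; rewrite -uE -vE -wE in tq ijk.
  have nuv : u != v by apply/eqP => E; move: ijk; rewrite E orientpp ltxx.
  have nvw : v != w by apply/eqP => E; move: ijk;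
    rewrite E (orientpq _ (b (other q w))).2 ltxx.
  have nwu : w != u by apply/eqP => E; move: ijk;
    rewrite E (orientpq (b (other q u)) _).1 ltxx.
  have /nocyc : (u, v, w) \in triples 5.
    by apply: allpairs_f; [apply: allpairs_f|]; rewrite mem_iota.
  have [tuv tvw twu] : [/\ 0 < orient (b q) (b (other q u)) (b (other q v)),
      0 < orient (b q) (b (other q v)) (b (other q w)) &
      0 < orient (b q) (b (other q w)) (b (other q u))].
    by case: tq => ? ? ?; split; rewrite orient_rot.
  rewrite /= !inE negb_or nuv nvw (eq_sym u w) nwu /= /cyc3 !t'E//= tuv tvw twu.
  by [].
have [_ [s]] := cyc0 ord0; rewrite mem_permutations => ps sp; exists s;
  split=> //.
have us : uniq s by rewrite (perm_uniq ps) iota_uniq.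
(* Distinctness of the entries is carried along because [t'E] holds off the diagonal. *)
rewrite uniq_pairwise in us; have := conj us sp.
move=> /andP; rewrite -pairwise_relI.
apply: (@sub_in_pairwise _ [pred x | (x < 5)%N]).
  by move=> x y; rewrite !inE => x5 y5 /andP[xy]; rewrite t'E.
by apply/allP => x; rewrite (perm_mem ps) mem_iota.
Qed.
End SixPoints.

(** * Obstacle representations of CE(6) *)

Lemma shatter6_false (R : realType) (X : set (R * R)) (b : 'I_6 -> R * R)
    (r : {set 'I_6} -> R * R) :
  connected X ->
  (forall i j, i != j -> misses X (b i) (b j)) ->
  (forall (A : {set 'I_6}) i, i \in A -> misses X (r A) (b i)) ->
  (forall (A : {set 'I_6}) i, i \notin A -> meets X (r A) (b i)) ->
  (forall i j k, uniq [:: i; j; k] -> orient (b i) (b j) (b k) != 0) ->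
  (forall A i j, i != j -> orient (r A) (b i) (b j) != 0) -> False.
Proof.
move=> cX bb vis blk genb genr.
have [[i [j [k [z [Xz tz]]]]]|out] :=
  pselect (exists i j k z, X z /\ tri (b i) (b j) (b k) z).
  have /= /and3P[] := orient_neq3 (tri_orient tz); rewrite !inE negb_or.
  move=> /andP[ij ik] jk _; have ki : k != i by rewrite eq_sym.
  apply: (inner_false cX bb vis blk genb genr (i := i) (j := j) (k := k)).
    by rewrite card_ord.
  exact: tri_dichotomy cX (bb _ _ ij) (bb _ _ jk) (bb _ _ ki) Xz tz.
apply: (outer_false cX bb vis blk genb genr) => i j k z Xz tz.
by apply: out; exists i, j, k, z.
Qed.

Lemma orient0_collinear (R : realType) (p q r : R * R) : p <> q ->
  orient p q r = 0 -> collinear p q r.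
Proof.
move=> pq; rewrite /orient => o0.
exists (p.2 - q.2), (q.1 - p.1), ((p.2 - q.2) * p.1 + (q.1 - p.1) * p.2).
split; last by split; [|ring|apply/eqP; rewrite -subr_eq0 -[X in _ == X]o0;
  apply/eqP; ring].
move=> [/eqP + /eqP]; rewrite !subr_eq0 => /eqP e2 /eqP e1; apply: pq.
by case: p q e1 e2 {o0} => p1 p2 [q1 q2] /= -> ->.
Qed.

Lemma blocked_meets (R : realType) (s : seq (R * R)) (p q : R * R) :
  ~ polygon s p -> ~ polygon s q -> segment p q `&` polygon s <> set0 ->
  meets (polygon_boundary s) p q.
Proof.
move=> sp sq /eqP/set0P/(segment_polygon_boundary sp)[z
  [/segment_lerp[t [/andP[t0 t1] ->]] bz]].
have lerp0 : lerp 0 p q = p.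
  by rewrite /lerp subr0 !mul1r !mul0r !addr0; case: (p).
have lerp1 : lerp 1 p q = q.
  by rewrite /lerp subrr !mul1r !mul0r !add0r; case: (q).
exists t => //; rewrite !lt_neqAle t0 t1 !andbT; apply/andP; split.
- by apply: contra_notN sp => /eqP t00; left; rewrite -t00 lerp0 in bz.
- by apply: contra_notN sq => /eqP t11; left; rewrite t11 lerp1 in bz.
Qed.

Lemma CE6_one_obstacle (R : realType) (P : set (R * R)) (s : seq (R * R)) :
  ~ obstacle_representation (CE 6) P [:: s].
Proof.
move=> [_ _ Ps gp [f [fI fP adj]]].
have sf u : ~ polygon s (f u).
  move=> sfu; have : P `&` polygon s = set0 by apply: Ps; rewrite inE.
  by apply/eqP/set0P; exists (f u); split=> //; rewrite -fP; exists u.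
have gen u v w : uniq [:: u; v; w] -> orient (f u) (f v) (f w) != 0.
  rewrite /= !inE negb_or andbT => /andP[/andP[uv uw] vw].
  have ne x y : x != y -> f x <> f y by move=> /eqP xy /fI.
  have inP x : (P `|` [set v | exists2 s0, s0 \in [:: s] & v \in s0]) (f x).
    by left; rewrite -fP; exists x.
  apply/eqP => /(orient0_collinear (ne _ _ uv)).
  exact: gp (inP u) (inP v) (inP w) (ne _ _ uv) (ne _ _ vw) (ne _ _ uw).
have miss u v : CE 6 u v -> misses (polygon_boundary s) (f u) (f v).
  move=> /adj[_ /(_ s)]; rewrite inE eqxx => /(_ isT) uv z uvz bz.
  by have : (segment (f u) (f v) `&` polygon s) z by [split=> //; left];
    rewrite uv.
have meet u v : u != v -> ~~ CE 6 u v -> meets (polygon_boundary s) (f u) (f v).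
  move=> /eqP uv nadj; apply: blocked_meets => // uv0.
  move/negP: nadj; apply; apply/adj; split=> [/fI//|s']; rewrite inE => /eqP ->.
  exact: uv0.
apply: (@shatter6_false R (polygon_boundary s) (fun i => f (inl i))
  (fun A => f (inr A))).
- exact: polygon_boundary_connected.
- by move=> i j ij; exact: miss.
- by move=> A i iA; exact: miss.
- by move=> A i iA; exact: meet.
- move=> i j k u; apply: gen.
  by rewrite -[uniq _]/(uniq (map inl [:: i; j; k])) map_inj_uniq// => ? ? [].
- by move=> A i j ij; apply: gen; rewrite /= !inE andbT; exact: ij.
Qed.

Theorem theorem8 (R : realType) : (1 < obstacle_number R (CE 6))%E.
Proof.
apply: (@lt_le_trans _ _ 2%:E); first by rewrite lte_fin ltr1n.
apply: le_ereal_inf_tmp => _ [obs [P rep] <-]; rewrite lee_fin ler_nat.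
case: obs rep => [|s [|//]] rep; last by case: (CE6_one_obstacle rep).
(* Without obstacles all distinct points see each other, but two red points are not adjacent. *)
case: rep => _ _ _ _ [f [fI _ adj]].
suff : CE 6 (inr finset.set0) (inr finset.setT) by [].
apply/adj; split=> // /fI[] /setP /(_ ord0).
by rewrite finset.in_set0 finset.in_setT.
Qed.
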